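(* Let $\mathcal C$ be a finite calculus of finitary rule schemas and $\Lambda$ a finite set of formulas. If $\mathcal C$ is $\Lambda$-analytic, then $\mathrm{Expand}$ (run, on a B-sequent $\Phi=(\Phi_{\mathsf A},\Phi_{\overline{\mathsf A}},\Phi_{\mathsf R},\Phi_{\overline{\mathsf R}})$, as $\mathrm{Expand}((\Phi_{\mathsf A},\Phi_{\mathsf R}),(\Phi_{\overline{\mathsf A}},\Phi_{\overline{\mathsf R}}),R^\Lambda_{\mathcal C}(\Phi))$) is a proof-search algorithm for $\mathcal C$ that runs in exponential time (in the size of $\Phi$) in general, and in polynomial time if $\mathcal C$ contains only rules with at most one formula in the succedent.
   Context: Formulas are those of a propositional language over a denumerable set $P$ of variables, with size $\mathrm{size}(q)=1$ for variables and $\mathrm{size}(\copyright(\varphi_1,\dots,\varphi_k))=1+\sum_i\mathrm{size}(\varphi_i)$; substitutions are endomorphisms; $\mathrm{sub}$ gives subformulas. A B-sequent is a quadruple $\Phi=(\Phi_{\mathsf A},\Phi_{\overline{\mathsf A}},\Phi_{\mathsf R},\Phi_{\overline{\mathsf R}})$ of finite sets of formulas; its size is the total size of its formulas; $\mathrm{sub}(\Phi)=\bigcup_\alpha\mathrm{sub}(\Phi_\alpha)$. A rule schema has antecedent $(\Delta_{\mathsf A},\Delta_{\mathsf R})$ and succedent $(\Delta_{\overline{\mathsf A}},\Delta_{\overline{\mathsf R}})$; finitary if all four sets are finite; instances arise by substitution; a calculus is a set of schemas. A derivation is a rooted tree (every branch ends in a leaf) with nodes labelled by pairs $(\Gamma_{\mathsf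 A},\Gamma_{\mathsf R})$ or by $\star$, each non-leaf node expanded by an instance with $\Delta_{\mathsf A}\subseteq\Gamma_{\mathsf A}$, $\Delta_{\mathsf R}\subseteq\Gamma_{\mathsf R}$: if the succedent is empty its only child is labelled $\star$; otherwise its children are exactly nodes labelled $(\Gamma_{\mathsf A}\cup\{\psi\},\Gamma_{\mathsf R})$, $\psi\in\Delta_{\overline{\mathsf A}}$, and $(\Gamma_{\mathsf A},\Gamma_{\mathsf R}\cup\{\psi\})$, $\psi\in\Delta_{\overline{\mathsf R}}$. Given $C=(\Phi_{\overline{\mathsf A}},\Phi_{\overline{\mathsf R}})$, a node is $C$-closed if labelled $\star$ or its label has $\Gamma_{\mathsf A}\cap\Phi_{\overline{\mathsf A}}\ne\emptyset$ or $\Gamma_{\mathsf R}\cap\Phi_{\overline{\mathsf R}}\ne\emptyset$; a tree is $C$-closed if all its leaves are. A proof of $\Phi$ in $\mathcal C$ is a derivation using instances of rules of $\mathcal C$ whose root label satisfies $\Gamma_{\mathsf A}\subseteq\Phi_{\mathsf A}$, $\Gamma_{\mathsf R}\subseteq\Phi_{\mathsf R}$ and which is $(\Phi_{\overline{\mathsf A}},\Phi_{\overline{\mathsf R}})$-closed. $\mathrm{sub}^\Lambda(\Phi)=\mathrm{sub}(\Phi)\cup\{\sigma(\psi):\psi\in\Lambda,\ \sigma(P)\subseteq\mathrm{sub}(\Phi)\}$; a proof is $\Lambda$-analytic if all non-$\star$ labels consist of formulas in $\mathrm{sub}^\Lambda(\Phi)$; $\mathcal C$ is $\Lambda$-analytic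 if every provable B-statement has a $\Lambda$-analytic proof. $R^\Lambda_{\mathcal C}(\Phi)$ is the set of instances of rules of $\mathcal C$ under substitutions using only formulas in $\mathrm{sub}^\Lambda(\Phi)$. A proof-search algorithm for $\mathcal C$ is one that on every B-sequent $\Phi$ terminates and returns a closed tree (a proof of $\Phi$) exactly when $\Phi$ is provable in $\mathcal C$. Procedure $\mathrm{Expand}(F,C,R)$ with $F=(\Gamma_{\mathsf A},\Gamma_{\mathsf R})$: (1) let $T$ be the one-node tree labelled $F$; (2) if $\Gamma_{\mathsf A}\cap\Phi_{\overline{\mathsf A}}\ne\emptyset$ or $\Gamma_{\mathsf R}\cap\Phi_{\overline{\mathsf R}}\ne\emptyset$, return $T$; (3) for each $r\in R$ (arbitrary order) with antecedent $(\Delta_{\mathsf A},\Delta_{\mathsf R})$, succedent $(\Delta_{\overline{\mathsf A}},\Delta_{\overline{\mathsf R}})$: if $\Delta_{\mathsf A}\subseteq\Gamma_{\mathsf A}$, $\Delta_{\mathsf R}\subseteq\Gamma_{\mathsf R}$, $\Delta_{\overline{\mathsf A}}\cap\Gamma_{\mathsf A}=\emptyset$, $\Delta_{\overline{\mathsf R}}\cap\Gamma_{\mathsf R}=\emptyset$, then (a) if $\Delta_{\overline{\mathsf A}}\cup\Delta_{\overline{\mathsf R}}=\emptyset$, return $T$ with a single child labelled $\star$; (b) for each $\psi\in\Delta_{\overline{\mathsf A}}$ (new pair $(\Gamma_{\mathsf A}\cup\{\psi\},\Gamma_{\mathsf R})$) and each $\psi\in\Delta_{\overline{\mathsf R}}$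 (new pair $(\Gamma_{\mathsf A},\Gamma_{\mathsf R}\cup\{\psi\})$): let $T'=\mathrm{Expand}(\text{new pair},C,R\setminus\{r\})$, attach the root of $T'$ as a child of the root of $T$, and if $T'$ is not $C$-closed return $T$; (c) if $T$ is $C$-closed, return $T$; (4) return $T$. *)

(* Defs.v *)
From HB Require Import structures.
From mathcomp Require Import all_boot.
From mathcomp Require Import finmap.

Set Implicit Arguments.
Unset Strict Implicit.
Unset Printing Implicit Defensive.

Local Open Scope fset_scope.
Local Open Scope nat_scope.

Unset Elimination Schemes.
Inductive form (Sig : choiceType) (ar : Sig -> nat) : Type :=
| Var (p : nat)
| App (c : Sig) (f : {ffun 'I_(ar c) -> form ar}).
Set Elimination Schemes.

Arguments Var {Sig ar} p.
Arguments App {Sig ar} c f.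

Lemma form_ind (Sig : choiceType) (ar : Sig -> nat) (K : form ar -> Prop) :
  (forall p, K (Var p)) ->
  (forall c (f : {ffun 'I_(ar c) -> form ar}), (forall i, K (f i)) ->
     K (App c f)) ->
  forall x, K x.
Proof.
by move=> KV KA; fix IH 1 => -[p|c f]; [apply: KV | apply: KA => i; apply: IH].
Qed.

Section FormChoice.
Variables (Sig : choiceType) (ar : Sig -> nat).
Notation tree := (GenTree.tree (nat + Sig)).

Fixpoint form_encode (x : form ar) : tree :=
  match x with
  | Var p => GenTree.Leaf (inl p)
  | App c f =>
      GenTree.Node 0
        (GenTree.Leaf (inr c) :: [seq form_encode (f i) | i : 'I_(ar c)])
  end.

Fixpoint form_decode (t : tree) : form ar :=
  match t with
  | GenTree.Leaf (inl p) => Var p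
  | GenTree.Node _ (GenTree.Leaf (inr c) :: ts) =>
      App c [ffun i : 'I_(ar c) => nth (Var 0) (map form_decode ts) i]
  | _ => Var 0
  end.

Lemma form_encodeK : cancel form_encode form_decode.
Proof.
elim=> // c f IH /=; congr (App c _); apply/ffunP => i; rewrite ffunE.
rewrite -map_comp (nth_map i) ?size_enum_ord ?ltn_ord //=.
by rewrite nth_ord_enum IH.
Qed.

HB.instance Definition _ := Choice.copy (form ar) (can_type form_encodeK).
End FormChoice.

Section Calculus.
Variables (Sig : choiceType) (ar : Sig -> nat).
Notation form := (form ar).

Fixpoint fsize (x : form) : nat :=
  match x with
  | Var _ => 1
  | App c f => (\sum_(i < ar c) fsize (f i)).+1
  end.

Fixpoint subst (s : nat -> form) (x : form) : form :=
  match x with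
  | Var p => s p
  | App c f => App c [ffun i => subst s (f i)]
  end.

(* The subformulas of x, listed with one entry per occurrence. *)
Fixpoint sub (x : form) : seq form :=
  x :: match x with
       | Var _ => [::]
       | App c f => flatten [seq sub (f i) | i : 'I_(ar c)]
       end.

Fixpoint vars (x : form) : seq nat :=
  match x with
  | Var p => [:: p]
  | App c f => flatten [seq vars (f i) | i : 'I_(ar c)]
  end.

(* (Gamma_A, Gamma_R) *)
Definition label : Type := ({fset form} * {fset form})%type.

(* Antecedent (Delta_A, Delta_R), succedent (co-Delta_A, co-Delta_R); since the
   four sets are finite, every rule is finitary. *)
Definition rule : Type := (label * label)%type.

Record bsequent := BSequent {
  phiA : {fset form};
  phicA : {fset form};
  phiR : {fset form};
  phicR : {fset form} }.

Implicit Types (x y : form) (A B : {fset form}) (G Cl : label) (r : rule).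
Implicit Types (Phi : bsequent) (C : {fset rule}) (L : {fset form}).

Definition bforms Phi : seq form :=
  enum_fset (phiA Phi) ++ enum_fset (phicA Phi)
  ++ enum_fset (phiR Phi) ++ enum_fset (phicR Phi).

Definition bsize Phi : nat := \sum_(x <- bforms Phi) fsize x.

Definition bsub Phi : seq form := flatten [seq sub x | x <- bforms Phi].

Definition rforms r : seq form :=
  enum_fset r.1.1 ++ enum_fset r.1.2 ++ enum_fset r.2.1 ++ enum_fset r.2.2.

Definition rule_subst (s : nat -> form) r : rule :=
  (([fset subst s x | x in r.1.1], [fset subst s x | x in r.1.2]),
   ([fset subst s x | x in r.2.1], [fset subst s x | x in r.2.2])).

Definition is_instance C r : Prop :=
  exists2 r0, r0 \in C & exists s, r = rule_subst s r0.

(* A signed formula: (true, x) asks for x to be added to Gamma_A,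
   (false, x) to Gamma_R. *)
Definition sform : Type := (bool * form)%type.

Definition extend G (g : sform) : label :=
  if g.1 then (g.2 |` G.1, G.2) else (G.1, g.2 |` G.2).

Definition goals r : seq sform :=
  [seq (true, x) | x <- enum_fset r.2.1]
  ++ [seq (false, x) | x <- enum_fset r.2.2].

(* The label None is the star. *)
Inductive tree := Node of option label & seq tree.

Definition root (t : tree) : option label := let: Node l _ := t in l.

Definition star : tree := Node None [::].

Fixpoint nodes (t : tree) : seq (option label) :=
  let: Node l ts := t in l :: flatten (map nodes ts).

Definition closed_node Cl (l : option label) : bool :=
  if l is Some G then
    (G.1 `&` Cl.1 != fset0) || (G.2 `&` Cl.2 != fset0)
  else true.

Fixpoint closed Cl (t : tree) : bool :=
  let: Node l ts := t in
  if ts is [::] then closed_node Cl l else all (closed Cl) ts.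

Inductive derivation C : tree -> Prop :=
| DLeaf l : derivation C (Node l [::])
| DStar G r :
    is_instance C r -> r.1.1 `<=` G.1 -> r.1.2 `<=` G.2 ->
    goals r = [::] ->
    derivation C (Node (Some G) [:: star])
| DBranch G r ts :
    is_instance C r -> r.1.1 `<=` G.1 -> r.1.2 `<=` G.2 ->
    goals r <> [::] ->
    perm_eq [seq root t | t <- ts] [seq Some (extend G g) | g <- goals r] ->
    (forall i, i < size ts -> derivation C (nth star ts i)) ->
    derivation C (Node (Some G) ts).

Definition is_proof C Phi (t : tree) : Prop :=
  [/\ derivation C t,
      exists G, [/\ root t = Some G, G.1 `<=` phiA Phi & G.2 `<=` phiR Phi]
    & closed (phicA Phi, phicR Phi) t].

Definition provable C Phi : Prop := exists t, is_proof C Phi t.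

Definition in_subL L Phi x : Prop :=
  x \in bsub Phi \/
  exists2 y, y \in L &
    exists2 s : nat -> form, (forall p, s p \in bsub Phi) & x = subst s y.

Definition analytic_tree L Phi (t : tree) : Prop :=
  forall G, Some G \in nodes t ->
  forall x, (x \in G.1) || (x \in G.2) -> in_subL L Phi x.

Definition analytic C L : Prop :=
  forall Phi, provable C Phi ->
  exists2 t, is_proof C Phi t & analytic_tree L Phi t.

(* The set of instances R: it is the instance, not just the substitution, that
   consists of formulas in sub^L(Phi). *)
Definition in_RL C L Phi r : Prop :=
  is_instance C r /\ (forall x, x \in rforms r -> in_subL L Phi x).

(* Programs.  A computation either aborts (None) or returns a value together
   with the number of elementary steps it took.  Formulas are read and written
   symbol by symbol, one step per symbol; variables and connectives are atomic,
   as they are for fsize.  A finite set is stored as the duplicate-free list of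
   its elements, and every list cell visited or built costs one step. *)
Definition M (T : Type) : Type := option (T * nat).

Definition ret {T} (a : T) : M T := Some (a, 0).

Definition tick {T} (n : nat) (m : M T) : M T :=
  if m is Some (a, k) then Some (a, n + k) else None.

Definition bind {T U} (m : M T) (f : T -> M U) : M U :=
  if m is Some (a, n) then tick n (f a) else None.

Local Notation "'let*' a := m 'in' k" := (bind m (fun a => k))
  (at level 200, a name, m at level 100, k at level 200).

Section Loops.
Variables T U : Type.

Fixpoint hasM (p : T -> M bool) (s : seq T) : M bool :=
  tick 1 (if s is a :: s' then
            let* b := p a in if b then ret true else hasM p s'
          else ret false).

Fixpoint allM (p : T -> M bool) (s : seq T) : M bool :=
  tick 1 (if s is a :: s' then
            let* b := p a in if b then allM p s' else ret false
          else ret true).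

Fixpoint filterM (p : T -> M bool) (s : seq T) : M (seq T) :=
  tick 1 (if s is a :: s' then
            let* b := p a in
            let* t := filterM p s' in
            ret (if b then a :: t else t)
          else ret [::]).

Fixpoint mapM (f : T -> M U) (s : seq T) : M (seq U) :=
  tick 1 (if s is a :: s' then
            let* b := f a in
            let* t := mapM f s' in
            ret (b :: t)
          else ret [::]).

Fixpoint undupM (eqT : T -> T -> M bool) (s : seq T) : M (seq T) :=
  tick 1 (if s is a :: s' then
            let* t := undupM eqT s' in
            let* b := hasM (eqT a) t in
            ret (if b then t else a :: t)
          else ret [::]).
End Loops.

Definition catmapM {T U} (f : T -> M (seq U)) (s : seq T) : M (seq U) :=
  let* ss := mapM f s in tick (size (flatten ss)) (ret (flatten ss)).

Definition andM (m n : M bool) : M bool :=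
  let* b := m in if b then n else ret false.

Definition negM (m : M bool) : M bool := let* b := m in ret (~~ b).

Definition eqM x y : M bool := tick (fsize x + fsize y) (ret (x == y)).

Definition memM x (s : seq form) : M bool := hasM (eqM x) s.

Definition subsetM (s t : seq form) : M bool := allM (fun x => memM x t) s.

Definition meetM (s t : seq form) : M bool := hasM (fun x => memM x t) s.

Definition eqsetM A B : M bool :=
  andM (subsetM (enum_fset A) (enum_fset B))
       (subsetM (enum_fset B) (enum_fset A)).

Definition eqruleM r r' : M bool :=
  andM (andM (eqsetM r.1.1 r'.1.1) (eqsetM r.1.2 r'.1.2))
       (andM (eqsetM r.2.1 r'.2.1) (eqsetM r.2.2 r'.2.2)).

Definition insertM x A : M {fset form} :=
  let* b := memM x (enum_fset A) in
  tick 1 (ret (if b then A else x |` A)).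

(* Finite maps from variables to formulas, as association lists. *)
Definition assignment : Type := seq (nat * form).

Fixpoint asg (a : assignment) (p : nat) : form :=
  if a is (q, x) :: a' then if p == q then x else asg a' p else Var p.

Fixpoint assignmentsM (ps : seq nat) (s : seq form) : M (seq assignment) :=
  tick 1 (if ps is p :: ps' then
            let* l := assignmentsM ps' s in
            catmapM (fun x => mapM (fun a => ret ((p, x) :: a)) l) s
          else ret [:: [::]]).

(* Read x, look up the variable occurrences of x in a, write the result. *)
Definition substM (a : assignment) x : M form :=
  tick (fsize x * (size a).+1 + fsize (subst (asg a) x)) (ret (subst (asg a) x)).

Definition setsubstM (a : assignment) A : M {fset form} :=
  let* s := mapM (substM a) (enum_fset A) in
  let* s' := undupM eqM s in
  ret [fset x in s'].

Definition rulesubstM (a : assignment) r : M rule :=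
  let* aA := setsubstM a r.1.1 in
  let* aR := setsubstM a r.1.2 in
  let* sA := setsubstM a r.2.1 in
  let* sR := setsubstM a r.2.2 in
  ret ((aA, aR), (sA, sR)).

Definition subformsM (s : seq form) : M (seq form) :=
  let* l := catmapM (fun x => tick (fsize x) (ret (sub x))) s in
  undupM eqM l.

(* sub^L(Phi); when sub(Phi) is empty there is no substitution into it, so that
   even the variable-free members of L do not contribute. *)
Definition subLM L Phi : M (seq form) :=
  let* s := subformsM (bforms Phi) in
  if nilp s then ret [::] else
  let* t := catmapM (fun y =>
              let* l := assignmentsM (undup (vars y)) s in
              mapM (fun a => substM a y) l) (enum_fset L) in
  undupM eqM (s ++ t).

(* R^L_C(Phi).  The calculus C and the set L are fixed, so that listing the
   variables of a rule of C (or of a formula of L) is not charged. *)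
Definition instancesM C L Phi : M (seq rule) :=
  let* u := subLM L Phi in
  let* s := subformsM u in
  let* t := catmapM (fun r =>
              let* l := assignmentsM
                          (undup (flatten [seq vars x | x <- rforms r])) s in
              mapM (fun a => rulesubstM a r) l) (enum_fset C) in
  let* t' := filterM (fun r => subsetM (rforms r) u) t in
  undupM eqruleM t'.

Definition closed_nodeM Cl (l : option label) : M bool :=
  if l is Some G then
    let* b := meetM (enum_fset G.1) (enum_fset Cl.1) in
    if b then ret true else meetM (enum_fset G.2) (enum_fset Cl.2)
  else ret true.

Fixpoint closedM Cl (t : tree) : M bool :=
  let: Node l ts := t in
  tick 1 (if ts is [::] then closed_nodeM Cl l else allM (closedM Cl) ts).

Definition extendM G (g : sform) : M label :=
  if g.1 then let* A := insertM g.2 G.1 in ret (A, G.2)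
  else let* A := insertM g.2 G.2 in ret (G.1, A).

Definition attach (t t' : tree) : tree :=
  let: Node l ts := t in Node l (rcons ts t').

Definition applicableM r G : M bool :=
  andM (andM (subsetM (enum_fset r.1.1) (enum_fset G.1))
             (subsetM (enum_fset r.1.2) (enum_fset G.2)))
       (andM (negM (meetM (enum_fset r.2.1) (enum_fset G.1)))
             (negM (meetM (enum_fset r.2.2) (enum_fset G.2)))).

(* A recursive call of expandM is identified by the instances and signed formulas
   that led to it; a schedule resolves, separately for each call, the arbitrary
   order in which the loops over R and over the succedents are run. *)
Definition trace : Type := seq (rule * sform).

Record schedule := Schedule {
  rule_order : trace -> seq rule -> seq rule;
  goal_order : trace -> rule -> seq sform -> seq sform;
  rule_orderP : forall h s, perm_eq (rule_order h s) s;
  goal_orderP : forall h r s, perm_eq (goal_order h r s) s }.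

Section Steps.
Variables (Cl F : label) (rec : rule -> sform -> seq rule -> M tree).

(* Expands the goals gs of r in turn; the boolean tells whether some subtree T'
   was not closed, in which case the call returns the tree built so far. *)
Fixpoint branchM r (R' : seq rule) (gs : seq sform) (T : tree)
    : M (bool * tree) :=
  tick 1 (if gs is g :: gs' then
            let* T' := rec r g R' in
            let T1 := attach T T' in
            let* c := closedM Cl T' in
            if c then branchM r R' gs' T1 else ret (true, T1)
          else ret (false, T)).

(* R is the set of instances given to the call, rs those still to be tried. *)
Fixpoint tryM (order : rule -> seq sform -> seq sform) (R rs : seq rule)
    (T : tree) : M tree :=
  tick 1 (if rs is r :: rs' then
            let* b := applicableM r F in
            if ~~ b then tryM order R rs' T
            else if nilp (goals r) then ret (attach T star)
            else
              let* R' := filterM (fun r' => negM (eqruleM r r')) R in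
              let* eT := branchM r R' (order r (goals r)) T in
              if eT.1 then ret eT.2 else
              let* c := closedM Cl eT.2 in
              if c then ret eT.2 else tryM order R rs' eT.2
          else ret T).
End Steps.

(* Expands F with the instances R, Cl being the closing pair; aborted when the
   recursion is deeper than depth. *)
Fixpoint expandM (s : schedule) (depth : nat) (h : trace)
    (F Cl : label) (R : seq rule) : M tree :=
  if depth is d.+1 then
    let T := Node (Some F) [::] in
    let* c := closed_nodeM Cl (Some F) in
    if c then ret T else
    tryM Cl F
      (fun r g R' => let* F' := extendM F g in
                     expandM s d ((r, g) :: h) F' Cl R')
      (goal_order s h) R (rule_order s h R) T
  else None.

Definition searchM C L (s : schedule) (depth : nat) Phi : M tree :=
  let* R := instancesM C L Phi in
  expandM s depth [::] (phiA Phi, phiR Phi) (phicA Phi, phicR Phi) R.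

Definition computes_RL C L : Prop :=
  forall Phi, exists R n,
    [/\ instancesM C L Phi = Some (R, n), uniq R
      & forall r, r \in R <-> in_RL C L Phi r].

(* Termination is the existence of a sufficient depth. *)
Definition proof_search_algorithm C
    (alg : schedule -> nat -> bsequent -> M tree) : Prop :=
  forall s Phi,
    (exists d T n, alg s d Phi = Some (T, n)) /\
    (forall d T n, alg s d Phi = Some (T, n) ->
       (closed (phicA Phi, phicR Phi) T <-> provable C Phi) /\
       (closed (phicA Phi, phicR Phi) T -> is_proof C Phi T)).

Definition runs_in (alg : schedule -> nat -> bsequent -> M tree)
    (f : nat -> nat) : Prop :=
  forall s d Phi T n, alg s d Phi = Some (T, n) -> n <= f (bsize Phi).

Definition polynomial_time alg : Prop :=
  exists k, runs_in alg (fun n => k * n ^ k + k).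

Definition exponential_time alg : Prop :=
  exists k, runs_in alg (fun n => 2 ^ (k * n ^ k + k)).

Definition succedents_le1 C : Prop :=
  forall r, r \in C -> #|` r.2.1| + #|` r.2.2| <= 1.

End Calculus.

(* Main.v *)
(* Every call of Expand applies at most one instance: once all the goals of an
   applicable instance have been expanded to closed trees, the tree is closed and
   returned.  Hence the recursion depth is at most |R| and the tree has at most
   1 + b + ... + b^|R| nodes, b bounding the succedents, whereas |R| is polynomial
   in the size of the B-sequent because C and L are fixed; the work charged to each
   node of the tree is polynomial.
   If the tree is not closed, the search has met a label G that is not closed and
   is saturated: each instance of R whose antecedent lies in G has a goal in G.
   In an L-analytic proof only instances of R are used, and choosing at each node
   a goal lying in G leads to a leaf inside G, which cannot be closed; so there is
   no proof. *)

From mathcomp Require Import all_boot.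
From mathcomp Require Import finmap zify.
Require Import Defs.

Set Implicit Arguments.
Unset Strict Implicit.
Unset Printing Implicit Defensive.

Local Open Scope fset_scope.
Local Open Scope nat_scope.

(** * Running times *)

(** The set sub^L(Phi) need not be closed under subformulas, and the substitution behind an instance
    is arbitrary. Its value at a variable of the rule is however a subformula of a formula of the
    instance, so it is enough to try all assignments into the subformulas of sub^L(Phi) and to
    filter the results. There are polynomially many, since the number of variables of a rule is
    fixed. This preparation has a determined value and is described by [computes]. The tree returned
    by the expansion depends on the schedule and may lack children, so it is described by a
    postcondition, [wp]. The cost of a call is measured against the number of nodes of the tree that
    it returns. The subtrees are tested for closedness again at each level, so that a node is paid
    for once per ancestor: the cost per node grows linearly with the depth and stays polynomial.
    Only the separate bound on the number of nodes distinguishes the two running times. *)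

Definition computes {T} (m : M T) (v : T) (c : nat) : Prop :=
  exists2 n, m = Some (v, n) & n <= c.

Lemma computes_ret T (v : T) : computes (ret v) v 0.
Proof. by exists 0. Qed.

Section Computes.
Variables T U : Type.
Implicit Types (m : M T) (f : T -> M U).

Lemma computes_le m v c c' : computes m v c -> c <= c' -> computes m v c'.
Proof. by case=> n -> le_c le_cc'; exists n => //; apply: leq_trans le_cc'. Qed.

Lemma computes_tick k m v c : computes m v c -> computes (tick k m) v (k + c).
Proof. by case=> n -> le_c; exists (k + n); rewrite // leq_add2l. Qed.

Lemma computes_bind m f v w c c' :
  computes m v c -> computes (f v) w c' -> computes (bind m f) w (c + c').
Proof.
by case=> n -> le_c [k /= -> le_c']; exists (n + k); rewrite // leq_add.
Qed.

Lemma computes_map m v c (f : T -> U) :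
  computes m v c -> computes (bind m (fun a => ret (f a))) (f v) c.
Proof. by move=> mv; rewrite -[c]addn0; apply: computes_bind mv (computes_ret _). Qed.
End Computes.

Section LoopCosts.
Variables (T : eqType) (U : Type).
Implicit Types (s : seq T) (c : nat).

(** The extra units in the two factors pay for the ticks of the cells and of the end of the list; an
    early exit only lowers the cost. *)
Lemma computes_has (p : T -> M bool) (q : pred T) s c :
  (forall a, a \in s -> computes (p a) (q a) c) ->
  computes (hasM p s) (has q s) ((size s).+1 * c.+1).
Proof.
elim: s => [|a s IH] pq /=.
  by apply: computes_le (computes_tick 1 (computes_ret _)) _; lia.
apply: (@computes_le _ _ _ (1 + (c + (size s).+1 * c.+1))); last by nia.
apply/computes_tick/(computes_bind (pq a (mem_head _ _))).
case: (q a); first exact: computes_le (computes_ret _) _.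
by apply: IH => b s_b; apply: pq; rewrite inE s_b orbT.
Qed.

Lemma computes_all (p : T -> M bool) (q : pred T) s c :
  (forall a, a \in s -> computes (p a) (q a) c) ->
  computes (allM p s) (all q s) ((size s).+1 * c.+1).
Proof.
elim: s => [|a s IH] pq /=.
  by apply: computes_le (computes_tick 1 (computes_ret _)) _; lia.
apply: (@computes_le _ _ _ (1 + (c + (size s).+1 * c.+1))); last by nia.
apply/computes_tick/(computes_bind (pq a (mem_head _ _))).
case: (q a); last exact: computes_le (computes_ret _) _.
by apply: IH => b s_b; apply: pq; rewrite inE s_b orbT.
Qed.

Lemma computes_filter (p : T -> M bool) (q : pred T) s c :
  (forall a, a \in s -> computes (p a) (q a) c) ->
  computes (filterM p s) (filter q s) ((size s).+1 * c.+1).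
Proof.
elim: s => [|a s IH] pq /=.
  by apply: computes_le (computes_tick 1 (computes_ret _)) _; lia.
apply: (@computes_le _ _ _ (1 + (c + (size s).+1 * c.+1))); last by nia.
apply/computes_tick/(computes_bind (pq a (mem_head _ _))).
apply: (computes_map (fun t => if q a then a :: t else t)).
by apply: IH => b s_b; apply: pq; rewrite inE s_b orbT.
Qed.

Lemma computes_mapM (f : T -> M U) (g : T -> U) s c :
  (forall a, a \in s -> computes (f a) (g a) c) ->
  computes (mapM f s) (map g s) ((size s).+1 * c.+1).
Proof.
elim: s => [|a s IH] fg /=.
  by apply: computes_le (computes_tick 1 (computes_ret _)) _; lia.
apply: (@computes_le _ _ _ (1 + (c + (size s).+1 * c.+1))); last by nia.
apply/computes_tick/(computes_bind (fg a (mem_head _ _))).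
apply: (computes_map (fun t => g a :: t)).
by apply: IH => b s_b; apply: fg; rewrite inE s_b orbT.
Qed.

End LoopCosts.

Section CatmapCosts.
Variables (T : eqType) (U : Type).
Implicit Types (s : seq T) (c : nat).

Lemma computes_catmap (f : T -> M (seq U)) (g : T -> seq U) s c l :
  (forall a, a \in s -> computes (f a) (g a) c /\ size (g a) <= l) ->
  computes (catmapM f s) (flatten (map g s)) ((size s).+1 * c.+1 + size s * l).
Proof.
move=> fg; apply: computes_bind (computes_mapM (fun a s_a => (fg a s_a).1)) _.
apply: computes_le (computes_tick _ (computes_ret _)) _; rewrite addn0.
elim: s fg => //= a s IH fg; rewrite size_cat mulSn leq_add //.
  by case: (fg a (mem_head _ _)).
by apply: IH => b s_b; apply: fg; rewrite inE s_b orbT.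
Qed.

Lemma size_flatten_map_le (g : T -> seq U) s l :
  (forall a, a \in s -> size (g a) <= l) -> size (flatten (map g s)) <= size s * l.
Proof.
elim: s => //= a s IH fg; rewrite size_cat mulSn leq_add ?fg ?mem_head //.
by apply: IH => b s_b; apply: fg; rewrite inE s_b orbT.
Qed.

End CatmapCosts.

Definition undup_cost (m c : nat) : nat := m.+1 * (m.+1 * c.+1).+1.

Lemma computes_undup (T : eqType) (e : T -> T -> M bool) (s : seq T) c :
  {in s &, forall a b, computes (e a b) (a == b) c} ->
  computes (undupM e s) (undup s) (undup_cost (size s) c).
Proof.
rewrite /undup_cost; elim: s => [|a s IH] es /=.
  by apply: computes_le (computes_tick 1 (computes_ret _)) _; lia.
apply: (@computes_le _ _ _ (1 + ((size s).+1 * ((size s).+1 * c.+1).+1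
                                 + (size s).+1 * c.+1))); last by nia.
apply/computes_tick/computes_bind.
  by apply: IH => b1 b2 s_b1 s_b2; apply: es; rewrite inE ?s_b1 ?s_b2 orbT.
(* The loop looks for [a] in the tail already freed of duplicates, which has the same elements as
   [s]. *)
have -> : (a \in s) = has (pred1 a) (undup s) by rewrite has_pred1 mem_undup.
apply: (computes_map (fun b : bool => if b then undup s else a :: undup s)).
apply: (@computes_le _ _ _ ((size (undup s)).+1 * c.+1)).
  apply: computes_has => b; rewrite mem_undup => s_b /=.
  by rewrite eq_sym; apply: es; rewrite ?mem_head // inE s_b orbT.
by rewrite leq_mul // ltnS size_undup.
Qed.

(** * Sizes of formulas, and the cost of comparing finite sets and rules *)

Section Formulas.
Variables (Sig : choiceType) (ar : Sig -> nat).
Notation form := (form ar).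
Implicit Types (x y : form) (s : seq form) (a : assignment ar) (G : label ar).

Lemma fsize_gt0 x : 0 < fsize x.
Proof. by case: x. Qed.

Lemma size_flatten_ord (T : Type) n (F : 'I_n -> seq T) :
  size (flatten [seq F i | i : 'I_n]) = \sum_(i < n) size (F i).
Proof.
by rewrite size_flatten sumnE /shape -map_comp big_map big_enum.
Qed.

Lemma mem_flatten_ord (T : eqType) n (F : 'I_n -> seq T) z :
  reflect (exists i, z \in F i) (z \in flatten [seq F i | i : 'I_n]).
Proof.
apply: (iffP flatten_mapP) => [[i _ Fz]|[i Fz]]; exists i => //.
by rewrite mem_enum.
Qed.

Lemma size_sub x : size (sub x) = fsize x.
Proof.
elim: x => //= c f IH; rewrite size_flatten_ord; congr _.+1.
by apply: eq_bigr => i _; apply: IH.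
Qed.

Lemma sub_refl x : x \in sub x.
Proof. by case: x => *; rewrite mem_head. Qed.

Lemma fsize_sub x y : y \in sub x -> fsize y <= fsize x.
Proof.
elim: x => [p|c f IH]; first by rewrite inE => /eqP->.
rewrite inE => /predU1P[-> //|/mem_flatten_ord[i /IH le_y]].
apply: leq_trans le_y _.
by rewrite [fsize (App c f)]/= (bigD1 i) //= ltnW // ltnS leq_addr.
Qed.

Lemma size_vars x : size (vars x) <= fsize x.
Proof.
elim: x => //= c f IH; rewrite size_flatten_ord leqW //.
by apply: leq_sum => i _; apply: IH.
Qed.

Lemma fsize_subst (t : nat -> form) B x :
  (forall p, fsize (t p) <= B) -> fsize (subst t x) <= fsize x * B.
Proof.
(* [B] is positive because it bounds the size of a formula; this pays for the connective in the
   [App] case. *)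
move=> tB; have B_gt0 : 0 < B := leq_trans (fsize_gt0 (t 0)) (tB 0).
elim: x => [p|c f IH] /=; first by rewrite mul1n.
rewrite mulSn big_distrl /= -add1n leq_add //.
by apply: leq_sum => i _; rewrite ffunE; apply: IH.
Qed.

(** Only finitely many values of a substitution matter, which lets association lists stand for total
    substitutions. *)
Lemma eq_in_subst (t t' : nat -> form) x :
  {in vars x, t =1 t'} -> subst t x = subst t' x.
Proof.
elim: x => [p|c f IH] tt'; first by apply: tt'; rewrite mem_head.
congr (App c _); apply/ffunP => i; rewrite !ffunE; apply: IH => p x_p.
by apply: tt'; apply/mem_flatten_ord; exists i.
Qed.

(** This confines the unknown substitution of an instance to the subformulas of the formulas of the
    instance. *)
Lemma sub_subst (t : nat -> form) x p : p \in vars x -> t p \in sub (subst t x).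
Proof.
elim: x => [q|c f IH]; first by rewrite inE => /eqP->; apply: sub_refl.
move=> /mem_flatten_ord[i x_p]; rewrite inE; apply/orP; right.
by apply/mem_flatten_ord; exists i; rewrite ffunE; apply: IH.
Qed.

(** One parameter bounds both the length of a list and the size of its entries, so that every later
    cost is a function of it alone. *)
Definition small B s : Prop := size s <= B /\ {in s, forall x, fsize x <= B}.

Definition small_label B G : Prop := small B G.1 /\ small B G.2.

Definition small_rule B (r : rule ar) : Prop :=
  small_label B r.1 /\ small_label B r.2.

Lemma small_sub B s s' : uniq s' -> {subset s' <= s} -> small B s -> small B s'.
Proof.
move=> Us' sub_s's [sB xB]; split=> [|x /sub_s's/xB//].
by apply: leq_trans (uniq_leq_size Us' sub_s's) sB.
Qed.

Lemma small_le B B' s : B <= B' -> small B s -> small B' s.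
Proof.
move=> le_BB' [sB xB]; split=> [|x /xB xB']; first exact: leq_trans le_BB'.
exact: leq_trans le_BB'.
Qed.

Definition mem_cost B : nat := B.+1 * (B + B).+1.
Definition subset_cost B : nat := B.+1 * (mem_cost B).+1.

Lemma computes_eqM x y : computes (eqM x y) (x == y) (fsize x + fsize y).
Proof. by apply: computes_le (computes_tick _ (computes_ret _)) _; lia. Qed.

Lemma computes_and m n (b b' : bool) c c' :
  computes m b c -> computes n b' c' -> computes (andM m n) (b && b') (c + c').
Proof.
move=> mb nb'; apply: computes_bind mb _.
by case: b => //; apply: computes_le (computes_ret _) _.
Qed.

Lemma computes_neg m (b : bool) c :
  computes m b c -> computes (negM m) (~~ b) c.
Proof. exact: computes_map. Qed.

Section SmallSets.
Variable B : nat.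

Lemma computes_mem x s :
  fsize x <= B -> small B s -> computes (memM x s) (x \in s) (mem_cost B).
Proof.
move=> xB [sB yB]; have -> : (x \in s) = has (fun y => x == y) s.
  by rewrite (eq_has (a2 := pred1 x)) ?has_pred1 // => y /=; rewrite eq_sym.
apply: computes_le (computes_has (q := fun y => x == y) (c := B + B) _) _.
  move=> y /yB le_yB; apply: computes_le (computes_eqM _ _) _.
  exact: leq_add.
by rewrite leq_mul.
Qed.

Lemma computes_subset s t :
  small B s -> small B t ->
  computes (subsetM s t) (all (mem t) s) (subset_cost B).
Proof.
move=> [sB xB] tB; apply: computes_le (computes_all (q := mem t) _) _.
  by move=> x /xB le_xB; apply: computes_mem.
by rewrite leq_mul.
Qed.

Lemma computes_meet s t :
  small B s -> small B t ->
  computes (meetM s t) (has (mem t) s) (subset_cost B).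
Proof.
move=> [sB xB] tB; apply: computes_le (computes_has (q := mem t) _) _.
  by move=> x /xB le_xB; apply: computes_mem.
by rewrite leq_mul.
Qed.

Lemma all_fset_sub (A A' : {fset form}) : all (mem (enum_fset A')) A = (A `<=` A').
Proof. by apply/allP/fsubsetP. Qed.

Lemma has_fset_meet (A A' : {fset form}) :
  has (mem (enum_fset A')) A = (A `&` A' != fset0).
Proof.
apply/hasP/fset0Pn => [[x Ax A'x]|[x]]; first by exists x; rewrite inE Ax.
by rewrite inE => /andP[Ax A'x]; exists x.
Qed.

Lemma computes_eqset (A A' : {fset form}) :
  small B A -> small B A' ->
  computes (eqsetM A A') (A == A') (subset_cost B + subset_cost B).
Proof.
move=> AB A'B; rewrite eqEfsubset -!all_fset_sub.
by apply: computes_and; apply: computes_subset.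
Qed.

(** Four components, each compared by two inclusions. *)
Definition eqrule_cost b : nat := 8 * subset_cost b.

Lemma computes_eqrule (r r' : rule ar) :
  small_rule B r -> small_rule B r' ->
  computes (eqruleM r r') (r == r') (eqrule_cost B).
Proof.
case: r r' => [[A1 A2] [A3 A4]] [[B1 B2] [B3 B4]] [[/= ? ?] [/= ? ?]].
move=> [[/= ? ?] [/= ? ?]]; rewrite !xpair_eqE.
apply: (@computes_le _ _ _ ((subset_cost B + subset_cost B) +
  (subset_cost B + subset_cost B) + ((subset_cost B + subset_cost B) +
  (subset_cost B + subset_cost B)))); last by rewrite /eqrule_cost; lia.
by do !apply: computes_and; apply: computes_eqset.
Qed.
End SmallSets.

(** * Assignments *)

Fixpoint assignments (ps : seq nat) s : seq (assignment ar) :=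
  if ps is p :: ps' then
    flatten [seq [seq (p, x) :: a | a <- assignments ps' s] | x <- s]
  else [:: [::]].

Lemma mem_assignments ps s a :
  (a \in assignments ps s) = (unzip1 a == ps) && all (mem s) (unzip2 a).
Proof.
elim: ps a => [|p ps IH] a /=; first by case: a => [|[]].
apply/flatten_mapP/idP => [[x s_x /mapP[a' + ->]]|].
  by rewrite IH /= s_x => /andP[/eqP-> ->]; rewrite eqxx.
case: a => //= -[q x] a /=; rewrite eqseq_cons -!andbA => /and4P[/eqP-> pa sx sa].
by exists x => //; apply: map_f; rewrite IH pa.
Qed.

Lemma size_assignments ps s : size (assignments ps s) = size s ^ size ps.
Proof.
elim: ps => //= p ps IH; rewrite size_flatten sumnE /shape -map_comp big_map.
under eq_bigr do rewrite /= size_map IH.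
by rewrite big_const_seq count_predT iter_addn_0 expnSr.
Qed.

Lemma asg_mem ps s a p : a \in assignments ps s -> p \in ps -> asg a p \in s.
Proof.
rewrite mem_assignments => /andP[/eqP<-].
elim: a => //= -[q x] a IH /= /andP[sx sa]; rewrite inE.
by case: eqP => //= _; apply: IH.
Qed.

(** The successor covers the default value [Var p] of [asg], of size 1, when [B] is zero. *)
Lemma fsize_asg ps s a p B :
  a \in assignments ps s -> {in s, forall x, fsize x <= B} -> fsize (asg a p) <= B.+1.
Proof.
move=> sa sB; have := sa; rewrite mem_assignments => /andP[_].
elim: a {sa} => //= -[q x] a IH /= /andP[sx sa].
by case: eqP => _; [apply/leqW/sB | apply: IH].
Qed.

Lemma asg_graph (t : nat -> form) ps p :
  p \in ps -> asg [seq (q, t q) | q <- ps] p = t p.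
Proof.
by elim: ps => //= q ps IH; rewrite inE; case: eqP => [->|_] //=.
Qed.

Lemma graph_assignments (t : nat -> form) ps s :
  {in ps, forall p, t p \in s} -> [seq (p, t p) | p <- ps] \in assignments ps s.
Proof.
move=> ts; rewrite mem_assignments /unzip1 /unzip2 -!map_comp map_id eqxx /=.
by apply/allP => _ /mapP[p ps_p ->]; apply: ts.
Qed.

Lemma subst_graph (t : nat -> form) ps x :
  {subset vars x <= ps} -> subst (asg [seq (p, t p) | p <- ps]) x = subst t x.
Proof. by move=> xps; apply: eq_in_subst => p /xps/asg_graph. Qed.

(** The exponent will be a constant of the calculus, which makes this a polynomial in [B]. The base
    [B.+1] is positive, hence the power is monotone in the exponent. *)
Lemma size_assignments_le ps s D B :
  size ps <= D -> size s <= B -> size (assignments ps s) <= B.+1 ^ D.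
Proof.
move=> psD sB; rewrite size_assignments (@leq_trans (B.+1 ^ size ps)) //.
  by case: (size ps) => // k; rewrite leq_exp2r // leqW.
by rewrite leq_pexp2l.
Qed.

Definition assignments_cost D B : nat :=
  D.+1 * (B.+1 * ((B.+1 ^ D).+1.*2).+1 + B.+1 * B.+1 ^ D).+1.

Lemma computes_assignments ps s D B :
  size ps <= D -> size s <= B ->
  computes (assignmentsM ps s) (assignments ps s) (assignments_cost D B).
Proof.
move=> psD sB; rewrite /assignments_cost.
(* [K] pays for the round of one variable with its tick, each round being charged at the largest
   length that the lists can reach. *)
set K := (X in _ * X); apply: (@computes_le _ _ _ ((size ps).+1 * K)); last first.
  by rewrite leq_mul.
elim: ps psD => [|p ps IH] psD /=.
  by apply: computes_le (computes_tick 1 (computes_ret _)) _; rewrite /K; lia.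
have K_gt0 : 0 < K by [].
apply: (@computes_le _ _ _ (1 + ((size ps).+1 * K + K.-1))); last by nia.
apply/computes_tick/(computes_bind (IH (ltnW psD))).
have le_l := size_assignments_le (ltnW psD) sB.
apply: computes_le (computes_catmap (c := (B.+1 ^ D).+1.*2) (l := B.+1 ^ D) _) _.
  move=> x s_x; split; last by rewrite size_map.
  apply: computes_le (computes_mapM (c := 0) _) _.
    by move=> a _; apply: computes_ret.
  by rewrite muln1 -addnn (leq_trans _ (leq_addr _ _)) // ltnS.
by rewrite /K /= leq_add // leq_mul // leqW.
Qed.
End Formulas.

(** * The set of instances *)

Section Instances.
Variables (Sig : choiceType) (ar : Sig -> nat).
Notation form := (form ar).
Implicit Types (x y : form) (s : seq form) (a : assignment ar) (r : rule ar).

Lemma size_assignment ps s a : a \in assignments ps s -> size a = size ps.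
Proof. by rewrite mem_assignments => /andP[/eqP<- _]; rewrite size_map. Qed.

(** The loop common to the instances of the formulas of [L] and to those of the rules of [C]. *)
Lemma computes_each_assignment (U : Type) (f : assignment ar -> M U) g ps s D B c :
  size ps <= D -> size s <= B ->
  {in assignments ps s, forall a, computes (f a) (g a) c} ->
  computes (bind (assignmentsM ps s) (mapM f)) (map g (assignments ps s))
    (assignments_cost D B + (B.+1 ^ D).+1 * c.+1).
Proof.
move=> psD sB fg; apply: computes_bind (computes_assignments psD sB) _.
apply: computes_le (computes_mapM fg) _.
by rewrite leq_mul // ltnS size_assignments_le.
Qed.

(** Reading at most [D] symbols, each with a lookup through at most [D] pairs, then writing a result
    of size at most [D * B.+1]. *)
Definition subst_cost D B : nat := D * D.+1 + D * B.+1.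

Lemma fsize_subst_asg x ps s a D B :
  fsize x <= D -> small B s -> a \in assignments ps s ->
  fsize (subst (asg a) x) <= D * B.+1.
Proof.
move=> xD [_ sB] sa; apply: (@leq_trans (fsize x * B.+1)); last by rewrite leq_mul.
by apply: fsize_subst => p; apply: fsize_asg sa sB.
Qed.

Lemma computes_subst x ps s a D B :
  fsize x <= D -> size ps <= D -> small B s -> a \in assignments ps s ->
  computes (substM a x) (subst (asg a) x) (subst_cost D B).
Proof.
move=> xD psD sB sa; apply: computes_le (computes_tick _ (computes_ret _)) _.
rewrite addn0 leq_add ?(fsize_subst_asg _ sB sa) // leq_mul //.
by rewrite ltnS (size_assignment sa).
Qed.

Definition setsubst_cost D B : nat :=
  D.+1 * (subst_cost D B).+1 + undup_cost D (D * B.+1 + D * B.+1).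

Lemma undup_cost_le m m' c c' :
  m <= m' -> c <= c' -> undup_cost m c <= undup_cost m' c'.
Proof.
move=> le_m le_c; rewrite /undup_cost; apply: leq_mul; first by [].
by rewrite ltnS; apply: leq_mul.
Qed.

Lemma fset_undup_map (f : form -> form) (A : {fset form}) :
  [fset x in undup (map f A)] = [fset f x | x in A].
Proof.
apply/fsetP => z; rewrite !inE mem_undup.
by apply/mapP/imfsetP => -[x /= Ax ->]; exists x.
Qed.

Lemma computes_setsubst (A : {fset form}) ps s a D B :
  small D A -> size ps <= D -> small B s -> a \in assignments ps s ->
  computes (setsubstM a A) [fset subst (asg a) x | x in A] (setsubst_cost D B).
Proof.
move=> [AD xD] psD sB sa; apply: (@computes_bind _ _ _ _ [seq subst (asg a) x | x <- A]).
  apply: computes_le (computes_mapM (g := subst (asg a)) (c := subst_cost D B) _) _.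
    by move=> x /xD le_xD; apply: computes_subst le_xD psD sB sa.
  by rewrite leq_mul.
rewrite -fset_undup_map; apply: (computes_map (fun s' => [fset x in s'])).
apply: computes_le (computes_undup (c := D * B.+1 + D * B.+1) _) _.
  move=> _ _ /mapP[x /xD le_x ->] /mapP[y /xD le_y ->].
  by apply: computes_le (computes_eqM _ _) _; rewrite leq_add // (fsize_subst_asg _ sB sa).
by rewrite undup_cost_le // size_map.
Qed.

Lemma computes_rulesubst r ps s a D B :
  small_rule D r -> size ps <= D -> small B s -> a \in assignments ps s ->
  computes (rulesubstM a r) (rule_subst (asg a) r) (4 * setsubst_cost D B).
Proof.
move=> [[AD RD] [cAD cRD]] psD sB sa.
apply: (@computes_le _ _ _ (setsubst_cost D B + (setsubst_cost D B +
  (setsubst_cost D B + setsubst_cost D B)))); last by lia.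
apply: computes_bind (computes_setsubst AD psD sB sa) _.
apply: computes_bind (computes_setsubst RD psD sB sa) _.
apply: computes_bind (computes_setsubst cAD psD sB sa) _.
exact: computes_map (computes_setsubst cRD psD sB sa).
Qed.

Lemma small_imfset (A : {fset form}) ps s a D B :
  small D A -> small B s -> a \in assignments ps s ->
  small (D * B.+1) [fset subst (asg a) x | x in A].
Proof.
move=> [AD xD] sB sa; split=> [|_ /imfsetP[x /xD/= le_x ->]].
  apply: (@leq_trans (size (enum_fset A))); last first.
    by apply: leq_trans AD _; rewrite leq_pmulr.
  rewrite -(size_map (subst (asg a)) A) uniq_leq_size ?fset_uniq //.
  by move=> _ /imfsetP[x Ax ->]; apply: map_f.
exact: fsize_subst_asg le_x sB sa.
Qed.

Lemma small_rule_subst r ps s a D B :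
  small_rule D r -> small B s -> a \in assignments ps s ->
  small_rule (D * B.+1) (rule_subst (asg a) r).
Proof.
by move=> [[AD RD] [cAD cRD]] sB sa; split; split; apply: small_imfset sB sa.
Qed.

(** * Subformulas and the set sub^L(Phi) *)

Definition subforms s : seq form := undup (flatten [seq sub x | x <- s]).

Definition subforms_cost B : nat :=
  B.+1 * B.+1 + B * B + undup_cost (B * B) (B + B).

Lemma small_subforms B s : small B s -> small (B * B) (subforms s).
Proof.
move=> [sB xB]; split=> [|y].
  apply: leq_trans (size_undup _) _; apply: leq_trans (size_flatten_map_le (l := B) _) _.
    by move=> x /xB; rewrite size_sub.
  by rewrite leq_mul.
rewrite mem_undup => /flatten_mapP[x /xB le_x /fsize_sub le_y].
by apply: leq_trans le_y (leq_trans le_x _); case: (B) => // b; rewrite leq_pmulr.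
Qed.

Lemma computes_subforms B s :
  small B s -> computes (subformsM s) (subforms s) (subforms_cost B).
Proof.
move=> sB; have [le_s xB] := sB.
apply: (@computes_bind _ _ _ _ (flatten [seq sub x | x <- s])).
  apply: computes_le (computes_catmap (g := @sub _ ar) (c := B) (l := B) _) _.
    move=> x /xB le_x; rewrite size_sub; split=> //.
    by apply: computes_le (computes_tick _ (computes_ret _)) _; rewrite addn0.
  by rewrite leq_add // leq_mul.
have yB y : y \in flatten [seq sub x | x <- s] -> fsize y <= B.
  by case/flatten_mapP=> x /xB le_x /fsize_sub/leq_trans; apply.
apply: computes_le (computes_undup (c := B + B) _) _.
  move=> y z /yB le_y /yB le_z; apply: computes_le (computes_eqM _ _) _.
  exact: leq_add.
apply: undup_cost_le => //; apply: leq_trans (size_flatten_map_le (l := B) _) _.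
  by move=> x /xB; rewrite size_sub.
by rewrite leq_mul.
Qed.

Variables (C : {fset rule ar}) (L : {fset form}).
Implicit Type Phi : bsequent ar.

Definition subL Phi : seq form :=
  let s := subforms (bforms Phi) in
  if nilp s then [::] else
  undup (s ++ flatten [seq [seq subst (asg a) y | a <- assignments (undup (vars y)) s]
                      | y <- L]).

Lemma mem_subforms_bsub Phi x : (x \in subforms (bforms Phi)) = (x \in bsub Phi).
Proof. by rewrite mem_undup. Qed.

Lemma mem_subL Phi x : x \in subL Phi <-> in_subL L Phi x.
Proof.
rewrite /subL; set s := subforms _.
have sE y : (y \in s) = (y \in bsub Phi) by apply: mem_subforms_bsub.
(* Without subformulas no total substitution takes its values among them, as its value at 0
   shows. *)
case: nilP => [s0|/eqP s_neq0].
  split=> // -[|[y _ [t tPhi _]]]; first by rewrite -sE s0.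
  by move: (tPhi 0); rewrite -sE s0.
rewrite mem_undup mem_cat /in_subL -sE; split.
  case/orP=> [s_x|/flatten_mapP[y Ly /mapP[a sa ->]]]; first by left.
  (* The substitution must take values in the subformulas of [Phi] also outside the variables of
     [y], where [asg a] may give its default; there it is replaced by some [x0]. *)
  right; exists y => //; have [x0 s_x0] : exists x0, x0 \in s.
    by case: (s) s_neq0 => // x0 s' _; exists x0; rewrite mem_head.
  exists (fun p => if p \in vars y then asg a p else x0) => [p|].
    rewrite -sE; case: ifP => // y_p; apply: asg_mem sa _.
    by rewrite mem_undup.
  by apply: eq_in_subst => p ->.
case=> [->//|[y Ly [t tPhi ->]]].
apply/orP; right; apply/flatten_mapP; exists y => //.
apply/mapP; exists [seq (p, t p) | p <- undup (vars y)].
  by apply: graph_assignments => p _; rewrite sE.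
by rewrite subst_graph // => p; rewrite mem_undup.
Qed.

(** * Instances of rules within sub^L(Phi), their number and size *)

Definition rvars r : seq nat := undup (flatten [seq vars x | x <- rforms r]).

Definition instances Phi : seq (rule ar) :=
  let u := subL Phi in
  undup [seq r <- flatten [seq [seq rule_subst (asg a) r
                               | a <- assignments (rvars r) (subforms u)] | r <- C]
        | all (mem u) (rforms r)].

Lemma mem_rforms r x :
  (x \in rforms r) = [|| x \in r.1.1, x \in r.1.2, x \in r.2.1 | x \in r.2.2].
Proof. by rewrite !mem_cat. Qed.

Lemma eq_in_rule_subst (t t' : nat -> form) r :
  {in rvars r, t =1 t'} -> rule_subst t r = rule_subst t' r.
Proof.
move=> tt'; have E x : x \in rforms r -> subst t x = subst t' x.
  move=> rx; apply: eq_in_subst => p xp; apply: tt'; rewrite mem_undup.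
  by apply/flatten_mapP; exists x.
by congr ((_, _), (_, _)); apply: eq_in_imfset => // x Ax;
  apply: E; rewrite mem_rforms Ax ?orbT.
Qed.

Lemma subst_rforms (t : nat -> form) r x :
  x \in rforms r -> subst t x \in rforms (rule_subst t r).
Proof.
by rewrite !mem_rforms => /or4P[] Ax; apply/or4P;
  [apply: Or41 | apply: Or42 | apply: Or43 | apply: Or44]; apply: in_imfset.
Qed.

(** Completeness: if all formulas of [rule_subst t r0] lie in [subL Phi], then [sub_subst] puts the
    values of [t] at the variables of [r0] in the subformulas of [subL Phi], so that the restriction
    of [t] to these variables has been listed. Soundness comes from the filter. *)
Lemma mem_instances Phi r : r \in instances Phi <-> in_RL C L Phi r.
Proof.
rewrite mem_undup mem_filter; split.
  case/andP=> /allP ur /flatten_mapP[r0 Cr0 /mapP[a _ Er]]; split.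
    by exists r0 => //; exists (asg a).
  by move=> x /ur /mem_subL.
case=> -[r0 Cr0 [t Er]] ur; apply/andP; split.
  by apply/allP => x /ur /mem_subL.
apply/flatten_mapP; exists r0 => //; apply/mapP.
exists [seq (p, t p) | p <- rvars r0]; last first.
  by rewrite Er; apply: eq_in_rule_subst => p /asg_graph->.
apply: graph_assignments => p; rewrite mem_undup => /flatten_mapP[x r0x xp].
rewrite mem_undup; apply/flatten_mapP; exists (subst t x); last exact: sub_subst.
by apply/mem_subL/ur; rewrite Er; apply: subst_rforms.
Qed.

(** A single constant, independent of [Phi], that bounds the numbers of rules and of formulas, their
    sizes, the number of variables of a rule and the length of a succedent. *)
Definition dim : nat :=
  size L + \sum_(y <- L) fsize y
  + (size C + \sum_(r <- C) \sum_(x <- rforms r) fsize x).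

Lemma dim_size_L : size L <= dim.
Proof. by rewrite /dim -addnA leq_addr. Qed.

Lemma dim_size_C : size C <= dim.
Proof. by rewrite /dim addnCA leq_addr. Qed.

Lemma leq_sum_mem (T : eqType) (F : T -> nat) (s : seq T) z :
  z \in s -> F z <= \sum_(w <- s) F w.
Proof. by move=> sz; rewrite (big_rem z) //= leq_addr. Qed.

Lemma leq_size_sum_fsize s : size s <= \sum_(x <- s) fsize x.
Proof.
by rewrite -sum1_size leq_sum // => x _; apply: fsize_gt0.
Qed.

Lemma dim_L y : y \in L -> fsize y <= dim.
Proof.
move/(leq_sum_mem (@fsize _ ar))/leq_trans; apply.
by rewrite /dim addnAC leq_addl.
Qed.

Lemma dim_C r : r \in C -> \sum_(x <- rforms r) fsize x <= dim.
Proof.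
move/(leq_sum_mem (fun r => \sum_(x <- rforms r) fsize x))/leq_trans; apply.
by rewrite /dim addnA leq_addl.
Qed.

Lemma dim_rvars r : r \in C -> size (rvars r) <= dim.
Proof.
move/dim_C; apply: leq_trans; apply: leq_trans (size_undup _) _.
rewrite size_flatten sumnE /shape -map_comp big_map.
by apply: leq_sum => x _; apply: size_vars.
Qed.

Lemma dim_rforms r : r \in C -> small dim (rforms r).
Proof.
move=> /dim_C le_r; split=> [|x rx].
  exact: leq_trans (leq_size_sum_fsize _) le_r.
exact: leq_trans (leq_sum_mem (@fsize _ ar) rx) le_r.
Qed.

Lemma small_rule_rforms B r : small B (rforms r) -> small_rule B r.
Proof.
move=> rB; split; split; apply: small_sub rB; rewrite ?fset_uniq // => x Ax;
  by rewrite mem_rforms Ax ?orbT.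
Qed.

(** The first two terms bound the number of formulas, the last one the size of the substituted
    formulas. *)
Definition subL_bound B : nat := B + dim * B.+1 ^ dim + dim * B.+1.

Definition subL_cost n : nat :=
  let B := n * n in let B1 := subL_bound B in
  subforms_cost n
  + (dim.+1 * (assignments_cost dim B + (B.+1 ^ dim).+1 * (subst_cost dim B).+1).+1
     + dim * B.+1 ^ dim + undup_cost B1 (B1 + B1)).

Lemma small_bforms Phi : small (bsize Phi) (bforms Phi).
Proof.
split; first exact: leq_size_sum_fsize.
by move=> x; apply: leq_sum_mem.
Qed.

Let subst_L s y : seq form :=
  [seq subst (asg a) y | a <- assignments (undup (vars y)) s].

Lemma small_subst_L B s :
  small B s -> small (subL_bound B) (s ++ flatten [seq subst_L s y | y <- L]).
Proof.
move=> [le_s xB]; split=> [|x].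
  rewrite size_cat -[X in X <= _]addn0 leq_add // leq_add //.
  apply: leq_trans (size_flatten_map_le (l := B.+1 ^ dim) _) _.
    move=> y Ly; rewrite size_map size_assignments_le //.
    by rewrite (leq_trans (size_undup _)) // (leq_trans (size_vars _)) // dim_L.
  by rewrite leq_mul ?dim_size_L.
rewrite mem_cat => /orP[/xB le_x|/flatten_mapP[y Ly /mapP[a sa ->]]].
  by rewrite (leq_trans le_x) // /subL_bound -addnA leq_addr.
apply: leq_trans (leq_addl _ _); exact: fsize_subst_asg (dim_L Ly) _ sa.
Qed.

Lemma small_subL Phi : small (subL_bound (bsize Phi * bsize Phi)) (subL Phi).
Proof.
rewrite /subL; case: nilP => // _.
apply: small_sub (undup_uniq _) _ (small_subst_L (small_subforms (small_bforms Phi))).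
by move=> x; rewrite mem_undup.
Qed.

Lemma computes_subL Phi :
  computes (subLM L Phi) (subL Phi) (subL_cost (bsize Phi)).
Proof.
rewrite /subL /subL_cost; set B := bsize Phi * bsize Phi.
have sB : small B (subforms (bforms Phi)) by apply/small_subforms/small_bforms.
apply: computes_bind (computes_subforms (small_bforms Phi)) _.
case: nilP => _; first exact: computes_le (computes_ret _) _.
set s := subforms _ in sB *; have [le_u uB] := small_subst_L sB.
apply: (@computes_bind _ _ _ _ (flatten [seq subst_L s y | y <- L])).
  apply: computes_le (computes_catmap (l := B.+1 ^ dim)
    (c := assignments_cost dim B + (B.+1 ^ dim).+1 * (subst_cost dim B).+1) _) _.
    move=> y Ly; have yD := dim_L Ly.
    have yvD : size (undup (vars y)) <= dim.
      by rewrite (leq_trans (size_undup _)) // (leq_trans (size_vars _)).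
    split; last by rewrite size_map size_assignments_le //; case: sB.
    apply: computes_each_assignment => // [|a sa]; first by case: sB.
    exact: computes_subst yD yvD sB sa.
  by rewrite leq_add ?leq_mul ?ltnS ?dim_size_L.
apply: computes_le (computes_undup (c := subL_bound B + subL_bound B) _) _.
  move=> x y /uB le_x /uB le_y; apply: computes_le (computes_eqM _ _) _.
  exact: leq_add.
exact: undup_cost_le.
Qed.

(** The bound used throughout the expansion: [B1] covers the formulas of [subL], the second term the
    number and size of the formulas of a candidate instance, the third the number of candidates. *)
Definition scale n : nat :=
  let B1 := subL_bound (n * n) in let B2 := B1 * B1 in
  B1 + 4 * (dim * B2.+1) + dim * B2.+1 ^ dim.

Definition instances_cost n : nat :=
  let B1 := subL_bound (n * n) in let B2 := B1 * B1 in let B3 := scale n in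
  subL_cost n + (subforms_cost B1 +
  (dim.+1 * (assignments_cost dim B2
             + (B2.+1 ^ dim).+1 * (4 * setsubst_cost dim B2).+1).+1
   + dim * B2.+1 ^ dim
   + (B3.+1 * (subset_cost B3).+1 + undup_cost B3 (eqrule_cost B3)))).

Lemma small_subL_scale Phi : small (scale (bsize Phi)) (subL Phi).
Proof. by apply: small_le (small_subL Phi); rewrite /scale -addnA leq_addr. Qed.

(** A substitution may identify formulas but adds none, so that a bound on the succedents of [C]
    passes to its instances. *)
Lemma goals_instance r : is_instance C r -> exists2 r0, r0 \in C &
  size (goals r) <= #|` r0.2.1| + #|` r0.2.2|.
Proof.
case=> r0 Cr0 [t ->]; exists r0 => //; rewrite size_cat !size_map.
by rewrite leq_add // leq_imfset_card.
Qed.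

Lemma size_goals_dim r : is_instance C r -> size (goals r) <= dim.
Proof.
case/goals_instance=> r0 /dim_rforms[le_r0 _] le_r.
by apply: leq_trans le_r (leq_trans _ le_r0); rewrite /rforms !size_cat addnA leq_addl.
Qed.

Lemma size_instances_raw (u : seq form) B : small B (subforms u) ->
  size (flatten [seq [seq rule_subst (asg a) r | a <- assignments (rvars r) (subforms u)]
                | r <- C]) <= dim * B.+1 ^ dim.
Proof.
move=> [uB _]; apply: leq_trans (size_flatten_map_le (l := B.+1 ^ dim) _) _.
  by move=> r /dim_rvars rD; rewrite size_map size_assignments_le.
by rewrite leq_mul ?dim_size_C.
Qed.

Lemma size_instances Phi : size (instances Phi) <= scale (bsize Phi).
Proof.
apply: leq_trans (size_undup _) _; rewrite size_filter; apply: leq_trans (count_size _ _) _.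
apply: leq_trans (leq_addl _ _).
exact/size_instances_raw/small_subforms/small_subL.
Qed.

Lemma computes_instances Phi :
  computes (instancesM C L Phi) (instances Phi) (instances_cost (bsize Phi)).
Proof.
rewrite /instances_cost; set B1 := subL_bound _; set B2 := B1 * B1; set B3 := scale _.
apply: computes_bind (computes_subL Phi) _; rewrite /instances.
have uB1 := small_subL Phi; have uB3 := small_subL_scale Phi.
set u := subL Phi in uB1 uB3 *.
apply: computes_bind (computes_subforms uB1) _.
have sB2 : small B2 (subforms u) by apply: small_subforms.
set s := subforms u in sB2 *.
set t := flatten _; have le_t : size t <= dim * B2.+1 ^ dim by apply: size_instances_raw.
(* The candidates are not filtered yet, so their formulas are bounded through the substitution and
   not through membership in [u]. *)
have tB r : r \in t -> small B3 (rforms r).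
  case/flatten_mapP=> r0 Cr0 /mapP[a sa ->].
  have [[[le1 A1] [le2 A2]] [[le3 A3] [le4 A4]]] :=
    small_rule_subst (small_rule_rforms (dim_rforms Cr0)) sB2 sa.
  split=> [|x]; last first.
    rewrite mem_rforms => rx; apply: (@leq_trans (dim * B2.+1)).
      by case/or4P: rx; [apply: A1 | apply: A2 | apply: A3 | apply: A4].
    by rewrite /B3 /scale -/B1 -/B2; lia.
  apply: (@leq_trans (4 * (dim * B2.+1))); last first.
    by rewrite /B3 /scale -addnA addnCA leq_addr.
  rewrite /rforms !size_cat !mulSn mul0n addn0.
  exact: leq_add le1 (leq_add le2 (leq_add le3 le4)).
apply: (@computes_bind _ _ _ _ t).
  apply: computes_le (computes_catmap (l := B2.+1 ^ dim)
    (c := assignments_cost dim B2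
          + (B2.+1 ^ dim).+1 * (4 * setsubst_cost dim B2).+1) _) _.
    move=> r Cr; have rD := dim_rvars Cr.
    split; last by rewrite size_map size_assignments_le //; case: sB2.
    apply: computes_each_assignment => // [|a sa]; first by case: sB2.
    exact: computes_rulesubst (small_rule_rforms (dim_rforms Cr)) rD sB2 sa.
  by rewrite leq_add ?leq_mul ?ltnS ?dim_size_C.
have le_tB3 : size t <= B3 by apply: leq_trans le_t (leq_addl _ _).
apply: (@computes_bind _ _ _ _ [seq r <- t | all (mem u) (rforms r)]).
  apply: computes_le (computes_filter (q := fun r => all (mem u) (rforms r)) _) _.
    by move=> r /tB rB; apply: (computes_subset rB uB3).
  by rewrite leq_mul.
apply: computes_le (computes_undup (c := eqrule_cost B3) _) _.
  move=> r r'; rewrite !mem_filter => /andP[_ tr] /andP[_ tr'].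
  by apply: computes_eqrule; apply/small_rule_rforms/tB.
rewrite undup_cost_le // size_filter; exact: leq_trans (count_size _ _) le_tB3.
Qed.
End Instances.

(** * The expansion procedure *)

Section WeakestPreconditions.
Variables T U : Type.

(* [Z] is the condition under which the computation may abort. *)
Definition wp (Z : Prop) {T} (m : M T) (Q : T -> nat -> Prop) : Prop :=
  if m is Some (a, n) then Q a n else Z.

Variable Z : Prop.
Implicit Types (m : M T) (f : T -> M U).

Lemma wp_tick k m (Q : T -> nat -> Prop) :
  wp Z m (fun a n => Q a (k + n)) -> wp Z (tick k m) Q.
Proof. by case: m => [[a n]|]. Qed.

Lemma wp_bind m f (Q : U -> nat -> Prop) :
  wp Z m (fun a n => wp Z (f a) (fun b k => Q b (n + k))) -> wp Z (bind m f) Q.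
Proof. by case: m => [[a n]|] //=; case: (f a) => [[b k]|]. Qed.

Lemma wp_computes m v c f (Q : U -> nat -> Prop) :
  computes m v c ->
  (forall n, n <= c -> wp Z (f v) (fun b k => Q b (n + k))) ->
  wp Z (bind m f) Q.
Proof. by case=> n -> le_n /(_ n le_n) fQ; apply: wp_bind. Qed.

Lemma wp_mono m (Q Q' : T -> nat -> Prop) :
  (forall a n, Q a n -> Q' a n) -> wp Z m Q -> wp Z m Q'.
Proof. by case: m => [[a n]|] //= QQ' /QQ'. Qed.
End WeakestPreconditions.

Section Trees.
Variables (Sig : choiceType) (ar : Sig -> nat).
Notation tree := (tree ar).
Implicit Types (t : tree) (ts : seq tree).

(** The hypothesis on the children is indexed as in [DBranch]; the inner induction on the list keeps
    the recursive calls on genuine subtrees. *)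
Lemma tree_nth_ind (K : tree -> Prop) :
  (forall l ts, (forall i, i < size ts -> K (nth (star _) ts i)) -> K (Node l ts)) ->
  forall t, K t.
Proof.
move=> KN; fix IH 1 => -[l ts]; apply: KN.
elim: ts => [i|t ts IHts [_|i]]; first (rewrite ltn0; discriminate).
  exact: (IH t).
exact: (IHts i).
Qed.

Lemma size_nodes_gt0 t : 0 < size (nodes t).
Proof. by case: t. Qed.

Lemma closed_Node Cl l ts : ts <> [::] -> closed Cl (@Node _ ar l ts) = all (closed Cl) ts.
Proof. by case: ts. Qed.
End Trees.

(** * Saturated labels *)

Section Saturation.
Variables (Sig : choiceType) (ar : Sig -> nat) (Cl : label ar).
Implicit Types (F G : label ar) (r : rule ar) (R : seq (rule ar)) (g : sform ar).

Definition hits G g : bool := if g.1 then g.2 \in G.1 else g.2 \in G.2.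

Definition saturated R G : Prop :=
  forall r, r \in R -> r.1.1 `<=` G.1 -> r.1.2 `<=` G.2 -> has (hits G) (goals r).

Definition stuck F R : Prop := exists G,
  [/\ F.1 `<=` G.1, F.2 `<=` G.2, ~~ closed_node Cl (Some G) & saturated R G].

Lemma stuck_extend F R r g :
  g \in goals r -> stuck (extend F g) [seq r' <- R | r != r'] -> stuck F R.
Proof.
move=> rg [G [F1 F2 nGCl satG]]; exists G.
have [hF1 hF2 hg] : [/\ F.1 `<=` G.1, F.2 `<=` G.2 & hits G g].
  move: F1 F2; rewrite /extend /hits; case: g {rg} => -[] x /=.
    by rewrite fsubUset fsub1set => /andP[-> ->] ->.
  by rewrite fsubUset fsub1set => -> /andP[-> ->].
split=> // r' Rr' r'1 r'2; have [<-|neq_r] := eqVneq r r'.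
  by apply/hasP; exists g.
by apply: satG => //; rewrite mem_filter neq_r.
Qed.

Definition applicable r G : bool :=
  (all (mem (enum_fset G.1)) r.1.1 && all (mem (enum_fset G.2)) r.1.2)
  && (~~ has (mem (enum_fset G.1)) r.2.1 && ~~ has (mem (enum_fset G.2)) r.2.2).

(** With the antecedent present, the test can only fail on a goal already in [G]; hence a label to
    which no instance applies is saturated. *)
Lemma applicable_hits r G : ~~ applicable r G -> r.1.1 `<=` G.1 -> r.1.2 `<=` G.2 ->
  has (hits G) (goals r).
Proof.
move=> + r1 r2; rewrite /applicable !all_fset_sub r1 r2.
by rewrite -negb_or negbK /goals has_cat !has_map.
Qed.
End Saturation.

(** * Correctness and cost of one call, by induction on the depth *)

Section Expand.
Variables (Sig : choiceType) (ar : Sig -> nat) (C : {fset rule ar}).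
Variables (Cl : label ar) (u : seq (form ar)) (B b : nat).
Implicit Types (F G : label ar) (r : rule ar) (R : seq (rule ar)) (g : sform ar).
Implicit Types (t : tree ar) (ts : seq (tree ar)).

(** The invariant that keeps labels small at every depth: the goals lie in [u], and a finite set of
    formulas of [u] is no longer than [u]. *)
Definition label_in G : Prop := {subset G.1 <= u} /\ {subset G.2 <= u}.

Hypotheses (uB : small B u) (Clu : label_in Cl) (b_gt0 : 0 < b).

Lemma small_label_in G : label_in G -> small_label B G.
Proof. by case=> *; split; apply: small_sub uB; rewrite ?fset_uniq. Qed.

Lemma small_rule_in r : {subset rforms r <= u} -> small_rule B r.
Proof.
move=> ru; split; apply: small_label_in; split=> x rx; apply: ru;
  by rewrite mem_rforms rx ?orbT.
Qed.

Lemma computes_closed_node l :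
  (forall G, l = Some G -> label_in G) ->
  computes (closed_nodeM Cl l) (closed_node Cl l) (2 * subset_cost B).
Proof.
case: l => [G /(_ _ erefl)/small_label_in[GB1 GB2]|_]; last first.
  exact: computes_le (computes_ret _) _.
have [ClB1 ClB2] := small_label_in Clu.
rewrite /= -!has_fset_meet mul2n -addnn.
apply: computes_bind (computes_meet GB1 ClB1) _.
by case: has => /=; [apply: computes_le (computes_ret _) _ | apply: computes_meet].
Qed.

(** The constant 3 pays for entering a node, for the end of the list of its children and for its own
    cell in the list of its parent. The last unit is still unspent at the root, whence the
    predecessor in [computes_closed]. *)
Definition closed_cost : nat := 2 * subset_cost B + 3.

Lemma computes_closed t :
  (forall G, Some G \in nodes t -> label_in G) ->
  computes (closedM Cl t) (closed Cl t) (closed_cost * size (nodes t)).-1.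
Proof.
elim/tree_nth_ind: t => l ts IH tu.
have [ts0|ts_neq0] := altP (@nilP _ ts).
  rewrite ts0 [size _]/= muln1 /closed_cost.
  apply: (@computes_le _ _ _ (1 + 2 * subset_cost B)); last by lia.
  apply/computes_tick/computes_closed_node => G El; apply: tu.
  by rewrite El mem_head.
have {tu} tsu G : Some G \in flatten (map (@nodes _ _) ts) -> label_in G.
  by move=> ts_G; apply: tu; rewrite inE ts_G orbT.
have allP : computes (allM (closedM Cl) ts) (all (closed Cl) ts)
                     (1 + closed_cost * size (flatten (map (@nodes _ _) ts))).
  elim: ts {ts_neq0} IH tsu => [|t ts IHts] IH tsu /=.
    by apply: computes_le (computes_tick _ (computes_ret _)) _.
  have t_gt0 := size_nodes_gt0 t.
  rewrite size_cat mulnDr.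
  apply: (@computes_le _ _ _ (1 + ((closed_cost * size (nodes t)).-1
    + (1 + closed_cost * size (flatten (map (@nodes _ _) ts)))))).
    apply/computes_tick/computes_bind.
      by apply: (IH 0) => // G tG; apply: tsu; rewrite mem_cat tG.
    case: closed; last exact: computes_le (computes_ret _) _.
    apply: IHts => [i lt_i|G ts_G]; first exact: (IH i.+1).
    by apply: tsu; rewrite mem_cat ts_G orbT.
  have : 0 < closed_cost * size (nodes t) by rewrite muln_gt0 t_gt0 /closed_cost addnC.
  by lia.
have -> : closedM Cl (Node l ts) = tick 1 (allM (closedM Cl) ts).
  by case: (ts) ts_neq0.
rewrite closed_Node; last by move=> E; rewrite E in ts_neq0.
apply: computes_le (computes_tick 1 allP) _.
have -> : size (nodes (Node l ts)) = (size (flatten (map (@nodes _ _) ts))).+1 by [].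
have : 3 <= closed_cost by rewrite /closed_cost leq_addl.
by rewrite mulnS; lia.
Qed.

Lemma computes_applicable r G :
  {subset rforms r <= u} -> label_in G ->
  computes (applicableM r G) (applicable r G) (4 * subset_cost B).
Proof.
move=> /small_rule_in[[r1 r2] [r3 r4]] /small_label_in[G1 G2].
apply: (@computes_le _ _ _ ((subset_cost B + subset_cost B)
                           + (subset_cost B + subset_cost B))); last by lia.
by do 2!apply: computes_and; try apply: computes_neg;
  (apply: computes_subset || apply: computes_meet).
Qed.

Lemma computes_extend F g : label_in F -> g.2 \in u ->
  computes (extendM F g) (extend F g) (mem_cost B).+1.
Proof.
move=> /small_label_in[F1 F2] ug; have [_ /(_ _ ug) gB] := uB.
have ins (A : {fset form ar}) : small B A ->
    computes (insertM g.2 A) (g.2 |` A) (mem_cost B).+1.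
  move=> AB; rewrite -addn1; apply: computes_bind (computes_mem gB AB) _.
  rewrite [X in computes _ X _](_ : _ = if g.2 \in A then A else g.2 |` A); last first.
    by case: ifP => // Ag; apply/fsetUidPr; rewrite fsub1set.
  exact: (computes_tick 1 (computes_ret _)).
rewrite /extendM /extend; case: g.1.
  exact: (computes_map (fun A => (A, F.2)) (ins _ F1)).
exact: (computes_map (fun A => (F.1, A)) (ins _ F2)).
Qed.

Lemma label_in_extend F g : label_in F -> g.2 \in u -> label_in (extend F g).
Proof.
move=> [F1 F2] ug; rewrite /extend; case: g.1; split=> //= x;
  by rewrite in_fset1U => /predU1P[-> //|]; first [apply: F1 | apply: F2].
Qed.

Lemma goals_rforms r g : g \in goals r -> g.2 \in rforms r.
Proof.
by rewrite mem_cat => /orP[] /mapP[x rx ->]; rewrite mem_rforms rx ?orbT.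
Qed.

(** [A] is the cost per node and [w] bounds the number of nodes. A call that meets a subtree that is
    not closed omits the remaining children, so the result is claimed to be a derivation only when
    it is closed. *)
Definition expanded F R (A w : nat) t n : Prop :=
  [/\ root t = Some F,
      closed Cl t -> derivation C t,
      ~~ closed Cl t -> stuck Cl F R,
      forall G, Some G \in nodes t -> label_in G
    & n <= A * size (nodes t) /\ size (nodes t) <= w].

(** Relative to the children [ts] attached before, for the induction over the goals; only the new
    ones, [ts'], are described. *)
Definition branched F R (A w : nat) ts (gs : seq (sform ar)) (et : bool * tree ar) n
    : Prop :=
  exists ts',
  [/\ et.2 = Node (Some F) (ts ++ ts'),
      if et.1 then ~~ all (closed Cl) ts' /\ exists2 g, g \in gs & stuck Cl (extend F g) R
      else [/\ all (closed Cl) ts',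
               forall i, i < size ts' -> derivation C (nth (star ar) ts' i)
             & map (@root _ ar) ts' = [seq Some (extend F g) | g <- gs]],
      forall G, Some G \in flatten (map (@nodes _ ar) ts') -> label_in G,
      n <= 1 + (A + closed_cost) * size (flatten (map (@nodes _ ar) ts'))
    & size (flatten (map (@nodes _ ar) ts')) <= size gs * w].

Lemma wp_branch Z (rec : rule ar -> sform ar -> seq (rule ar) -> M (tree ar))
    r F R A w gs ts :
  (forall g, g \in gs -> wp Z (rec r g R) (expanded (extend F g) R A w)) ->
  wp Z (branchM Cl rec r R gs (Node (Some F) ts)) (branched F R A w ts gs).
Proof.
elim: gs ts => [|g gs IH] ts recP /=.
  by exists [::]; rewrite cats0.
apply/wp_tick/wp_bind; apply: wp_mono (recP g (mem_head _ _)).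
move=> t n [root_t der_t stuck_t tu [le_n le_w]].
apply: wp_computes (computes_closed tu) _ => n' le_n'.
have le_n1 : n' < closed_cost * size (nodes t).
  have : 0 < closed_cost * size (nodes t).
    by rewrite muln_gt0 size_nodes_gt0 /closed_cost addnC.
  by lia.
case: ifP => [cl_t|/negbT ncl_t].
  apply: wp_mono (IH (rcons ts t) _) => [[e T] k [ts' /= [-> Pe tsu le_k le_ts']]|]; last first.
    by move=> g' gs_g'; apply: recP; rewrite inE gs_g' orbT.
  exists (t :: ts'); split=> /=.
  - by rewrite cat_rcons.
  - case: e Pe => [[ncl_ts' [g' gs_g' stuck_g']]|[cl_ts' der_ts' root_ts']].
      by rewrite cl_t; split=> //; exists g'; rewrite // inE gs_g' orbT.
    rewrite cl_t root_t root_ts'; split=> // -[|i] lt_i /=; first exact: der_t.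
    exact: der_ts'.
  - by move=> G; rewrite mem_cat => /orP[/tu|/tsu].
  - rewrite size_cat mulnDr mulnDl; lia.
  - by rewrite size_cat mulSn leq_add.
exists [:: t]; split=> /=.
- by rewrite cats1.
- by rewrite andbT; split=> //; exists g; rewrite ?mem_head //; apply: stuck_t.
- by rewrite cats0.
- rewrite cats0 mulnDl; lia.
- by rewrite cats0 mulSn (leq_trans le_w) ?leq_addr.
Qed.

(** The applicability tests are counted for every instance, the filtering of [R] once, since the
    loop ends with the first applicable instance. *)
Definition try_cost (k : nat) : nat :=
  k.+1 * (4 * subset_cost B).+1 + B.+1 * (eqrule_cost B).+1 + 2.

Lemma try_costS k : try_cost k.+1 = (4 * subset_cost B).+1 + try_cost k.
Proof. by rewrite /try_cost mulSn !addnA. Qed.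

Lemma try_cost_ge k : B.+1 * (eqrule_cost B).+1 + 2 <= try_cost k.
Proof. by rewrite /try_cost -addnA leq_addl. Qed.

(** The loop invariant is that the instances passed over are not applicable to [F]; if the list is
    exhausted, [F] itself is therefore saturated. The term [2 * closed_cost] accounts for two
    closedness tests, one of each subtree and one of the whole tree. *)
Lemma wp_try Z (rec : rule ar -> sform ar -> seq (rule ar) -> M (tree ar))
    (order : rule ar -> seq (sform ar) -> seq (sform ar)) F R (rs : seq (rule ar)) A w :
  (forall r s, perm_eq (order r s) s) -> label_in F -> size R <= B ->
  ~~ closed_node Cl (Some F) ->
  (forall r, r \in R ->
     [/\ is_instance C r, size (goals r) <= b & {subset rforms r <= u}]) ->
  (forall r g, r \in R -> g \in goals r ->
     wp Z (rec r g [seq r' <- R | r != r'])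
        (expanded (extend F g) [seq r' <- R | r != r'] A w)) ->
  0 < w -> {subset rs <= R} ->
  (forall r, r \in R -> r \notin rs -> ~~ applicable r F) ->
  wp Z (tryM Cl F rec order R rs (Node (Some F) [::]))
    (fun t n => [/\ root t = Some F,
      closed Cl t -> derivation C t,
      ~~ closed Cl t -> stuck Cl F R,
      forall G, Some G \in nodes t -> label_in G
    & n <= try_cost (size rs) + (A + 2 * closed_cost) * size (nodes t) /\
      size (nodes t) <= 1 + b * w]).
Proof.
move=> orderP Fu RB nclF Rok recP w_gt0; elim: rs => [|r rs IH] rsR inapp /=.
  split.
  - by [].
  - by move=> _; apply: DLeaf.
  - move=> _; exists F; split=> // r Rr r1 r2; apply: applicable_hits => //; exact: inapp.
  - by move=> G; rewrite inE => /eqP[->].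
  - by split; [rewrite /try_cost; lia | rewrite leq_addr].
have Rr : r \in R by apply: rsR; rewrite mem_head.
have [inst_r r_b ru] := Rok r Rr.
apply: wp_tick; apply: wp_computes (computes_applicable ru Fu) _ => n0 le_n0.
case: (boolP (applicable r F)) => [app_r|napp_r]; last first.
  apply: wp_mono (IH _ _) => [t n [? ? ? ? [le_n ?]]|r' r'rs|r' Rr' r'_rs].
  - by split=> //; split=> //; rewrite try_costS; lia.
  - by apply: rsR; rewrite inE r'rs orbT.
  - have [->//|neq_r] := eqVneq r' r.
    by apply: inapp; rewrite // inE negb_or neq_r.
have [r1 r2] : r.1.1 `<=` F.1 /\ r.1.2 `<=` F.2.
  by move: app_r; rewrite /applicable !all_fset_sub => /andP[/andP[]].
rewrite /=; case: nilP => [goals0|goals_neq0].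
  split.
  - by [].
  - by move=> _; apply: DStar inst_r r1 r2 goals0.
  - by [].
  - by move=> G; rewrite !inE => /orP[/eqP[->]|].
  (* The star is a child although there are no goals; positivity of [b] makes room for it. *)
  - by split; [rewrite /try_cost; nia | rewrite -[size _]/2 add1n ltnS muln_gt0 b_gt0].
set R' := [seq r' <- R | r != r'].
have filterR : computes (filterM (fun r' => negM (eqruleM r r')) R) R'
                        (B.+1 * (eqrule_cost B).+1).
  apply: computes_le (computes_filter (q := fun r' => r != r') _) _.
    move=> r' /Rok[_ _ r'u]; apply: computes_neg.
    exact: computes_eqrule (small_rule_in ru) (small_rule_in r'u).
  by rewrite leq_mul.
apply: wp_computes filterR _ => n1 le_n1; apply: wp_bind.
have mem_order g : (g \in order r (goals r)) = (g \in goals r).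
  exact/perm_mem/orderP.
apply: wp_mono (wp_branch (w := w) (A := A) _ _); last first.
  by move=> g; rewrite mem_order; apply: recP.
move=> [e t] n2 [ts /= [-> Pe tsu le_n2 le_ts]].
have le_nodes : size (nodes (Node (Some F) ts)) <= 1 + b * w.
  rewrite /= add1n ltnS (leq_trans le_ts) // leq_mul //.
  by rewrite (perm_size (orderP _ _)).
have sizeE : size (nodes (Node (Some F) ts)) = (size (flatten (map (@nodes _ ar) ts))).+1.
  by [].
have tu G : Some G \in nodes (Node (Some F) ts) -> label_in G.
  by rewrite inE => /predU1P[[->]|/tsu].
case: e Pe => [[ncl_ts [g rg stuck_g]]|[cl_ts der_ts root_ts]] /=.
  have ts_neq0 : ts <> [::] by move=> E; rewrite E in ncl_ts.
  have clE := closed_Node Cl (Some F) ts_neq0.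
  split=> //.
  - by move=> cl; case/negP: ncl_ts; rewrite -clE.
  - by move=> _; rewrite mem_order in rg; apply: stuck_extend rg stuck_g.
  - split=> //; rewrite ?sizeE try_costS; have := try_cost_ge (size rs).
    by move: (size (flatten _)) le_n2 => N; lia.
(* Without children the node would be tested as a leaf. *)
have ts_neq0 : ts <> [::].
  move=> E; have := perm_size (orderP r (goals r)).
  rewrite -(size_map (fun g => Some (extend F g))) -root_ts E.
  by move/esym/size0nil.
have clE := closed_Node Cl (Some F) ts_neq0.
apply: wp_computes (computes_closed tu) _ => n3 le_n3; rewrite clE cl_ts.
split=> //.
- move=> _; apply: DBranch inst_r r1 r2 goals_neq0 _ der_ts.
  by rewrite root_ts perm_map.
- move=> ncl; case/negP: ncl.
  by rewrite -[X in is_true X]/(closed Cl (Node (Some F) ts)) clE.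
- split=> //; move: le_n3; rewrite ?sizeE try_costS; have := try_cost_ge (size rs).
  by move: (size (flatten _)) le_n2 => N; lia.
Qed.

Fixpoint tree_bound (m : nat) : nat := if m is m'.+1 then 1 + b * tree_bound m' else 1.

Lemma tree_bound_gt0 m : 0 < tree_bound m.
Proof. by case: m. Qed.

Definition expand_cost : nat :=
  2 * subset_cost B + try_cost B + (mem_cost B).+1 + 2 * closed_cost.

(** What a call pays once is absorbed in the cost per node, since the tree has at least one node. *)
Lemma expand_cost_step n0 n k N e :
  n0 <= 2 * subset_cost B -> k <= try_cost B -> 0 < N ->
  n <= k + (e + (mem_cost B).+1 + 2 * closed_cost) * N ->
  n0 + n <= (expand_cost + e) * N.
Proof.
rewrite /expand_cost; move: (2 * subset_cost B) (try_cost B) (mem_cost B).+1.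
move: (2 * closed_cost) => x1 x2 x3 x4 le_n0 le_k N_gt0 le_n.
have := (leq_pmulr x2 N_gt0, leq_pmulr x3 N_gt0); case; lia.
Qed.

(** Each level removes the applied instance, so that [m] decreases together with [d] and depth
    [m.+1] never aborts. Each level adds one [expand_cost] to the cost per node. *)
Lemma wp_expand (s : schedule ar) d h F R m :
  size R <= m -> m <= B -> label_in F ->
  (forall r, r \in R ->
     [/\ is_instance C r, size (goals r) <= b & {subset rforms r <= u}]) ->
  wp (d <= m) (expandM s d h F Cl R)
     (expanded F R (expand_cost * m.+1) (tree_bound m.+1)).
Proof.
elim: d h F R m => [|d IH] h F R m Rm mB Fu Rok //=.
have FuP G : Some F = Some G -> label_in G by case=> <-.
apply: wp_computes (computes_closed_node FuP) _ => n0 le_n0.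
have Fu1 G : Some G \in [:: Some F] -> label_in G by rewrite inE => /eqP[->].
case: ifP => [clF|/negbT nclF].
  split.
  - by [].
  - by move=> _; apply: DLeaf.
  - by rewrite -[closed _ _]/(closed_node Cl (Some F)) clF.
  - by [].
  - split; last by rewrite leq_addr.
    rewrite -[size _]/1 muln1 addn0 (leq_trans le_n0) //.
    by rewrite (leq_trans _ (leq_pmulr _ _)) // /expand_cost -!addnA leq_addr.
have RB := leq_trans Rm mB.
have orderP := rule_orderP s h R.
(* The summand [(mem_cost B).+1] pays for extending the label before a recursive call. *)
apply: wp_mono (wp_try (w := tree_bound m) (A := expand_cost * m + (mem_cost B).+1)
                       _ _ _ _ _ _ _ _ _) => //.
- move=> t n [root_t der_t stuck_t tu [le_n le_w]]; split=> //; split=> //.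
  rewrite (perm_size orderP) in le_n; have t_gt0 := size_nodes_gt0 t.
  have : try_cost (size R) <= try_cost B by rewrite /try_cost !leq_add // leq_mul.
  by move=> le_try; rewrite mulnS; apply: expand_cost_step le_n0 le_try t_gt0 le_n.
- by move=> r gs; apply: goal_orderP.
- move=> r g Rr rg; have [_ _ ru] := Rok r Rr.
  have ug : g.2 \in u by apply/ru/goals_rforms.
  case: m Rm mB => [|m] Rm mB; first by case: (R) Rm Rr.
  have R'm : size [seq r' <- R | r != r'] <= m.
    rewrite -ltnS (leq_trans _ Rm) // size_filter -(count_predC (pred1 r) R).
    rewrite (eq_count (a2 := predC (pred1 r))) => [|r']; last by rewrite /= eq_sym.
    by rewrite -add1n leq_add2r -has_count has_pred1.
  apply: wp_computes (computes_extend Fu ug) _ => n1 le_n1.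
  apply: wp_mono (IH _ _ _ m R'm (ltnW mB) (label_in_extend Fu ug) _).
    move=> t n [? ? ? ? [le_n ?]]; split=> //; split=> //.
    rewrite mulnDl addnC leq_add // (leq_trans le_n1) //.
    by rewrite leq_pmulr ?size_nodes_gt0.
  by move=> r'; rewrite mem_filter => /andP[_ /Rok].
- exact: tree_bound_gt0.
- by move=> r; rewrite (perm_mem orderP).
- by move=> r; rewrite (perm_mem orderP) => ->.
Qed.
End Expand.

(** * Polynomial bounds *)

(** The base is at least 2, so that constants and sums are absorbed by raising the exponent, the
    only parameter. *)
Definition poly_bounded (f : nat -> nat) : Prop := exists k, forall n, f n <= n.+2 ^ k.

Lemma poly_const c : poly_bounded (fun=> c).
Proof.
exists c => n; rewrite (@leq_trans (2 ^ c)) //; first by rewrite ltnW // ltn_expl.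
by case: c => // c; rewrite leq_exp2r.
Qed.

Lemma poly_id : poly_bounded id.
Proof. by exists 1 => n; rewrite expn1 !leqW. Qed.

Lemma poly_mul f g : poly_bounded f -> poly_bounded g -> poly_bounded (fun n => f n * g n).
Proof.
by move=> [j fj] [k gk]; exists (j + k) => n; rewrite expnD leq_mul.
Qed.

Lemma poly_add f g : poly_bounded f -> poly_bounded g -> poly_bounded (fun n => f n + g n).
Proof.
move=> [j fj] [k gk]; exists (j + k).+1 => n; rewrite expnS.
have le_jk i : i <= j + k -> n.+2 ^ i <= n.+2 ^ (j + k) by move=> ?; rewrite leq_pexp2l.
have := (fj n, gk n, le_jk _ (leq_addr k j), le_jk _ (leq_addl j k)).
by case=> [[[]]]; move: (n.+2 ^ _) (n.+2 ^ _) (n.+2 ^ _) => x y z; nia.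
Qed.

Lemma poly_succ f : poly_bounded f -> poly_bounded (fun n => (f n).+1).
Proof.
move=> pf; have [k fk] := poly_add (poly_const 1) pf; exists k => n; exact: fk.
Qed.

Lemma poly_exp f c : poly_bounded f -> poly_bounded (fun n => f n ^ c).
Proof.
move=> [k fk]; exists (k * c) => n; rewrite expnM.
by case: c => // c; rewrite leq_exp2r.
Qed.

Lemma poly_comp f g : poly_bounded f -> poly_bounded g -> poly_bounded (fun n => f (g n)).
Proof.
move=> [k fk] pg; have [j gj] := poly_exp k (poly_succ (poly_succ pg)).
by exists j => n; apply: leq_trans (fk _) (gj n).
Qed.

Lemma poly_boundedE f : poly_bounded f -> exists k, forall n, f n <= k * n ^ k + k.
Proof.
(* For positive [n], [n.+2] is at most [3 * n], which gives the factor [3 ^ k]; it exceeds [k],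
   hence serves as exponent, and as additive constant it covers [2 ^ k] at 0. *)
move=> [k fk]; exists (3 ^ k) => n; apply: leq_trans (fk n) _.
case: n => [|n].
  by apply: leq_trans (leq_addl _ _); case: (k) => // c; rewrite leq_exp2r.
apply: leq_trans (leq_addr _ _); apply: (@leq_trans ((3 * n.+1) ^ k)).
  by case: (k) => // c; rewrite leq_exp2r //; lia.
by rewrite expnMn leq_mul // leq_pexp2l // ltnW // ltn_expl.
Qed.

(* The shape is matched syntactically: unification would unfold the arithmetic. *)
Ltac poly_bound := repeat (first
  [ assumption
  | lazymatch goal with
    | |- poly_bounded (fun n => @?f n + @?g n) => apply: (@poly_add f g)
    | |- poly_bounded (fun n => @?f n * @?g n) => apply: (@poly_mul f g)
    | |- poly_bounded (fun n => @?f n ^ ?c) => apply: (@poly_exp f c)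
    | |- poly_bounded (fun n => (@?f n).+1) => apply: (@poly_succ f)
    | |- poly_bounded (fun n => n) => exact: poly_id
    | |- poly_bounded (fun n => ?c) => exact: (poly_const c)
    end ]).

Lemma poly_mem_cost : poly_bounded mem_cost.
Proof. by rewrite /mem_cost; poly_bound. Qed.

Lemma poly_subset_cost : poly_bounded subset_cost.
Proof. by have := poly_mem_cost; rewrite /subset_cost => ?; poly_bound. Qed.

Lemma poly_eqrule_cost : poly_bounded eqrule_cost.
Proof. by have := poly_subset_cost; rewrite /eqrule_cost => ?; poly_bound. Qed.

Lemma poly_assignments_cost D : poly_bounded (assignments_cost D).
Proof.
suff [k le_k] : poly_bounded (fun B =>
    D.+1 * (B.+1 * ((B.+1 ^ D).+1 + (B.+1 ^ D).+1).+1 + B.+1 * B.+1 ^ D).+1).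
  by exists k => n; rewrite /assignments_cost -addnn.
by poly_bound.
Qed.

Lemma poly_subst_cost D : poly_bounded (subst_cost D).
Proof. by rewrite /subst_cost; poly_bound. Qed.

Lemma poly_setsubst_cost D : poly_bounded (setsubst_cost D).
Proof.
have := poly_subst_cost D; rewrite /setsubst_cost /undup_cost => ?.
by poly_bound.
Qed.

Lemma poly_subforms_cost : poly_bounded subforms_cost.
Proof. by rewrite /subforms_cost /undup_cost; poly_bound. Qed.

(** * Running time of the whole search *)

Section Search.
Variables (Sig : choiceType) (ar : Sig -> nat).
Variables (C : {fset rule ar}) (L : {fset form ar}).
Implicit Types (Phi : bsequent ar) (F G Cl : label ar).

Lemma poly_subL_bound : poly_bounded (subL_bound C L).
Proof. by rewrite /subL_bound; poly_bound. Qed.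

Lemma poly_subL_bound2 : poly_bounded (fun n => subL_bound C L (n * n)).
Proof. by apply: (poly_comp poly_subL_bound); poly_bound. Qed.

Lemma poly_subL_cost : poly_bounded (subL_cost C L).
Proof.
have p1 := poly_subforms_cost; have p2 := poly_subL_bound2.
have sq : poly_bounded (fun n => n * n) by poly_bound.
have p3 := poly_comp (poly_assignments_cost (dim C L)) sq.
have p4 := poly_comp (poly_subst_cost (dim C L)) sq.
by rewrite /subL_cost /undup_cost; lazy zeta; poly_bound.
Qed.

Lemma poly_scale : poly_bounded (scale C L).
Proof. by have := poly_subL_bound2; rewrite /scale => ?; lazy zeta; poly_bound. Qed.

Lemma poly_instances_cost : poly_bounded (instances_cost C L).
Proof.
have p0 := poly_subL_cost; have p1 := poly_subL_bound2; have p2 := poly_scale.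
have p3 := poly_comp poly_subforms_cost p1.
have sq : poly_bounded (fun n => subL_bound C L (n * n) * subL_bound C L (n * n)).
  by poly_bound.
have p4 := poly_comp (poly_assignments_cost (dim C L)) sq.
have p5 := poly_comp (poly_setsubst_cost (dim C L)) sq.
have p6 := poly_comp poly_subset_cost p2.
have p7 := poly_comp poly_eqrule_cost p2.
by rewrite /instances_cost /undup_cost; lazy zeta; poly_bound.
Qed.

Lemma poly_expand_cost : poly_bounded expand_cost.
Proof.
have p1 := poly_subset_cost; have p2 := poly_mem_cost; have p3 := poly_eqrule_cost.
by rewrite /expand_cost /try_cost /closed_cost; poly_bound.
Qed.

Definition search_cost (b n : nat) : nat :=
  let B := scale C L n in
  instances_cost C L n + expand_cost B * B.+1 * tree_bound b B.+1.

Lemma tree_bound_le b m : tree_bound b m <= b.+1 ^ m.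
Proof.
elim: m => //= m IH; rewrite expnS mulSn leq_add ?expn_gt0 //.
by rewrite leq_mul.
Qed.

(** With at most one goal per instance the tree is a path. *)
Lemma tree_bound1 m : tree_bound 1 m = m.+1.
Proof. by elim: m => //= m ->; rewrite mul1n. Qed.

Lemma search_cost_poly : exists k, forall n, search_cost 1 n <= k * n ^ k + k.
Proof.
apply: poly_boundedE; have p1 := poly_instances_cost; have p2 := poly_scale.
have p3 := poly_comp poly_expand_cost p2.
suff [k le_k] : poly_bounded (fun n => instances_cost C L n
    + expand_cost (scale C L n) * (scale C L n).+1 * (scale C L n).+2).
  by exists k => n; rewrite /search_cost tree_bound1.
by poly_bound.
Qed.

Lemma search_cost_exp b : exists k, forall n, search_cost b n <= 2 ^ (k * n ^ k + k).
Proof.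
have p1 := poly_instances_cost; have p2 := poly_scale.
have p3 := poly_comp poly_expand_cost p2.
(* The exponent also collects the polynomial factors, through [n < 2 ^ n]; likewise [b.+1 <= 2 ^ b]
   turns the bound on the tree into a power of 2. *)
have [k le_k] : exists k, forall n, (instances_cost C L n
    + expand_cost (scale C L n) * (scale C L n).+1) + b * (scale C L n).+1
    <= k * n ^ k + k.
  by apply: poly_boundedE; poly_bound.
exists k => n; apply: leq_trans (leq_pexp2l _ (le_k n)) => //.
rewrite /search_cost; move: (scale C L n) (instances_cost C L n) => B X.
move: (expand_cost B * B.+1) => Y.
have le_tree : tree_bound b B.+1 <= 2 ^ (b * B.+1).
  by rewrite (leq_trans (tree_bound_le _ _)) // expnM leq_exp2r // ltn_expl.
rewrite expnD (@leq_trans ((X + Y) * 2 ^ (b * B.+1))) //.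
  by rewrite mulnDl leq_add ?leq_mul // leq_pmulr // expn_gt0.
by rewrite leq_mul // ltnW // ltn_expl.
Qed.

(** * Correctness of the search *)

Lemma bsub_bforms Phi x : x \in bforms Phi -> x \in bsub Phi.
Proof. by move=> Phi_x; apply/flatten_mapP; exists x => //; apply: sub_refl. Qed.

Lemma mem_bforms Phi x : (x \in bforms Phi) =
  [|| x \in phiA Phi, x \in phicA Phi, x \in phiR Phi | x \in phicR Phi].
Proof. by rewrite !mem_cat. Qed.

Lemma bforms_subL Phi x : x \in bforms Phi -> x \in subL L Phi.
Proof. by move=> Phi_x; apply/mem_subL; left; apply: bsub_bforms. Qed.

(** The branching bound [b] is left free: it will be a constant of the calculus in general, and 1
    for the polynomial case. *)
Lemma wp_search s d Phi b :
  0 < b -> (forall r, is_instance C r -> size (goals r) <= b) ->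
  wp (d <= scale C L (bsize Phi)) (searchM C L s d Phi)
    (fun T n => [/\ root T = Some (phiA Phi, phiR Phi),
       closed (phicA Phi, phicR Phi) T -> derivation C T,
       ~~ closed (phicA Phi, phicR Phi) T ->
         stuck (phicA Phi, phicR Phi) (phiA Phi, phiR Phi) (instances C L Phi)
     & n <= search_cost b (bsize Phi)]).
Proof.
move=> b_gt0 goals_b; set B := scale C L _.
apply: wp_computes (computes_instances C L Phi) _ => n0 le_n0.
have inP Psi : (forall x, (x \in Psi.1) || (x \in Psi.2) -> x \in bforms Phi) ->
    label_in (subL L Phi) Psi.
  by move=> Psi_Phi; split=> x Psi_x; apply/bforms_subL/Psi_Phi; rewrite Psi_x ?orbT.
apply: wp_mono (wp_expand (C := C) (b := b) (m := B) (small_subL_scale C L Phi)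
                          _ _ _ _ _ _ _ _ _) => //.
- move=> T n [-> der_T stuck_T _ [le_n le_T]]; split=> //.
  by apply: leq_add => //; apply: leq_trans le_n _; apply: leq_mul.
- by apply: inP => x /= Phi_x; rewrite mem_bforms; case/orP: Phi_x => ->; rewrite ?orbT.
- exact: size_instances.
- by apply: inP => x /= Phi_x; rewrite mem_bforms; case/orP: Phi_x => ->; rewrite ?orbT.
- move=> r /mem_instances[inst_r ur]; split=> //; first exact: goals_b.
  by move=> x /ur/mem_subL.
Qed.

Lemma nodes_nth G ts l i : i < size ts ->
  Some G \in nodes (nth (star ar) ts i) -> Some G \in nodes (Node l ts).
Proof.
move=> lt_i G_i; rewrite inE; apply/orP; right; apply/flattenP.
exists (nodes (nth (star ar) ts i)) => //.
by rewrite -(nth_map _ [::]) // mem_nth // size_map.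
Qed.

Lemma root_nodes (t : tree ar) : root t \in nodes t.
Proof. by case: t => *; apply: mem_head. Qed.

(* A branch of the derivation is followed by choosing, at each node, a goal that
   already belongs to [G]; it keeps inside [G], so that its leaf is not closed. *)
Lemma saturated_not_closed Phi Cl G t :
  saturated (instances C L Phi) G -> ~~ closed_node Cl (Some G) ->
  derivation C t -> analytic_tree L Phi t ->
  forall F, root t = Some F -> F.1 `<=` G.1 -> F.2 `<=` G.2 -> ~~ closed Cl t.
Proof.
move=> satG nclG; elim=> {t}.
- move=> l _ F /= -> F1 F2; apply: contra nclG => /=.
  by case/orP=> /fset0Pn[x]; rewrite inE => /andP[Fx Cx]; apply/orP; [left|right];
    apply/fset0Pn; exists x; rewrite inE Cx andbT;
    [apply: (fsubsetP F1) | apply: (fsubsetP F2)].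
- move=> F r inst_r r1 r2 goals0 ana _ [<-] F1 F2.
  (* An empty succedent contradicts saturation at once. *)
  suff : has (hits G) (goals r) by rewrite goals0.
  apply: satG; [|exact: fsubset_trans F1|exact: fsubset_trans F2].
  apply/mem_instances; split=> // x; rewrite mem_rforms => /or4P[rx|rx|rx|rx].
  + by apply: (ana F); rewrite ?mem_head // (fsubsetP r1).
  + by apply: (ana F); rewrite ?mem_head // (fsubsetP r2) ?orbT.
  + have : (true, x) \in goals r by rewrite mem_cat map_f.
    by rewrite goals0.
  + have : (false, x) \in goals r by rewrite mem_cat orbC map_f.
    by rewrite goals0.
move=> F r ts inst_r r1 r2 _ roots _ IH ana _ [<-] F1 F2.
have child g : g \in goals r ->
    exists2 i, i < size ts & root (nth (star ar) ts i) = Some (extend F g).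
  move=> rg; have : Some (extend F g) \in map (@root _ ar) ts.
    by rewrite (perm_mem roots) (map_f (fun g => Some (extend F g))).
  case/(nthP None)=> i; rewrite size_map => lt_i; rewrite (nth_map (star ar)) // => <-.
  by exists i.
(* Analyticity speaks of labels, and every goal occurs in the label of a child; with the antecedent,
   which lies in [F], this makes [r] one of the instances for which [G] is saturated. *)
have goal_in g : g \in goals r -> in_subL L Phi g.2.
  move=> /child[i lt_i root_i]; apply: (ana (extend F g)).
    by apply: nodes_nth lt_i _; rewrite -root_i root_nodes.
  by rewrite /extend; case: g.1; rewrite /= fset1U1 ?orbT.
have : has (hits G) (goals r).
  apply: satG; [|exact: fsubset_trans F1|exact: fsubset_trans F2].
  apply/mem_instances; split=> // x; rewrite mem_rforms => /or4P[rx|rx|rx|rx].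
  + by apply: (ana F); rewrite ?mem_head // (fsubsetP r1).
  + by apply: (ana F); rewrite ?mem_head // (fsubsetP r2) ?orbT.
  + by apply: (goal_in (true, x)); rewrite mem_cat map_f.
  + by apply: (goal_in (false, x)); rewrite mem_cat orbC map_f.
case/hasP=> g rg hit_g; have [i lt_i root_i] := child g rg.
have ts_neq0 : ts <> [::] by move=> E; rewrite E in lt_i.
rewrite closed_Node // -has_predC; apply/(has_nthP (star ar)); exists i => //=.
apply: (IH i lt_i) root_i _ _; first by move=> G' G'_i; apply/ana/(nodes_nth _ lt_i).
  by move: hit_g; rewrite /hits /extend; case: g.1 => //= Gg; rewrite fsubUset fsub1set Gg.
by move: hit_g; rewrite /hits /extend; case: g.1 => //= Gg; rewrite fsubUset fsub1set Gg.
Qed.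

Lemma stuck_not_provable Phi : analytic C L ->
  stuck (phicA Phi, phicR Phi) (phiA Phi, phiR Phi) (instances C L Phi) ->
  ~ provable C Phi.
Proof.
move=> anaC [G [F1 F2 nclG satG]] /anaC[t [der_t [F [root_t FA FR]] cl_t] ana_t].
have := saturated_not_closed satG nclG der_t ana_t root_t.
by rewrite cl_t => /(_ (fsubset_trans FA F1) (fsubset_trans FR F2)).
Qed.
End Search.

Theorem theorem3 (Sig : choiceType) (ar : Sig -> nat)
    (C : {fset rule ar}) (L : {fset form ar}) :
  analytic C L ->
  [/\ computes_RL C L,
      proof_search_algorithm C (searchM C L),
      exponential_time (searchM C L)
    & succedents_le1 C -> polynomial_time (searchM C L)].
Proof.
(* The successor makes the branching bound positive, as [wp_search] requires. *)
move=> anaC; have goals_dim r : is_instance C r -> size (goals r) <= (dim C L).+1.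
  by move=> /size_goals_dim/leqW.
split.
- move=> Phi; have [n RE _] := computes_instances C L Phi.
  exists (instances C L Phi), n; split=> //; first exact: undup_uniq.
  by move=> r; apply: mem_instances.
- move=> s Phi; split=> [|d T n runT].
    (* An abort at this depth would make it at most its own predecessor. *)
    exists (scale C L (bsize Phi)).+1.
    have := wp_search L s (scale C L (bsize Phi)).+1 Phi (ltn0Sn _) goals_dim.
    by case: searchM => [[T n] _|]; [exists T, n | rewrite /= ltnn].
  have := wp_search L s d Phi (ltn0Sn _) goals_dim.
  rewrite runT => -[root_T der_T stuck_T _].
  have proof_T : closed (phicA Phi, phicR Phi) T -> is_proof C Phi T.
    move=> cl_T; split=> //; first exact: der_T.
    by exists (phiA Phi, phiR Phi); rewrite !fsubset_refl.
  split=> //; split=> [/proof_T|prov]; first by exists T.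
  by case: (boolP (closed _ T)) => // /stuck_T/(stuck_not_provable anaC).
- have [k le_k] := search_cost_exp C L (dim C L).+1; exists k => s d Phi T n runT.
  have := wp_search L s d Phi (ltn0Sn _) goals_dim.
  by rewrite runT => -[_ _ _ /leq_trans->].
move=> C1; have [k le_k] := search_cost_poly C L; exists k => s d Phi T n runT.
have goals1 r : is_instance C r -> size (goals r) <= 1.
  by case/goals_instance=> r0 /C1 le1 /leq_trans->.
have := wp_search L s d Phi (ltn0Sn 0) goals1.
by rewrite runT => -[_ _ _ /leq_trans->].
Qed.
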